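(* Let $\mathcal{N}=(Q,Act,\delta)$ be a one-counter net, with planes, $HF,VF,SF$, $\alpha_P$, $\ell_P$, $\mathrm{mind},\mathrm{maxd},\mathrm{spand}$, $\leq_L,\leq_R$, $\mathcal{P}_{ms}$, and neighbourhoods as defined in the context. Then: (1) For each $P\in SF$, $\alpha_P=\Delta_y/\Delta_x$ where $\Delta_x,\Delta_y$ are integers in $[1,|\mathcal{P}_{ms}(\alpha_P)|]$. (2) Let $VF\cup SF=\{P_1,\dots,P_z\}$ with $P_1\leq_L P_2\leq_L\dots\leq_L P_z$, and let $\sigma_L(i)$ be the number of equivalence classes of $\approx_L$ represented in $\{P_1,\dots,P_i\}$. Then for each $i\in[1,z]$, every point of $\mathrm{rnb}_{\sigma_L(i)}(\ell_{P_i})$ is white in $P_i$. (3) Let $HF\cup SF=\{P_1,\dots,P_z\}$ with $P_1\leq_R P_2\leq_R\dots\leq_R P_z$, and let $\sigma_R(i)$ be the number of equivalence classes of $\approx_R$ represented in $\{P_1,\dots,P_i\}$. Then for each $i\in[1,z]$, every point of $\mathrm{lnb}_{\sigma_R(i)}(\ell_{P_i})$ is black in $P_i$. (4) There is a polynomial $pol$, independent of the net $\mathcal{N}$, such that: if $P\in HF$ and $f_P(n)<\infty$ then $f_P(n)\leq pol(|Q|)$; and if $P\in VF$ and $f_P(n)<\max\{f_P(n')\mid n'\in\mathbb{N}\}$ then $n\leq pol(|Q|)$.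
   Context: A one-counter net is $\mathcal{N}=(Q,Act,\delta)$ with finite $Q$, $Act$ and rules $\delta\subseteq Q\times Act\times\{-1,0,1\}\times Q$; its LTS has states $q(m)\in Q\times\mathbb{N}$ with $q(m)\xrightarrow{a}q'(n)$ iff $(q,a,n-m,q')\in\delta$; $\preceq$ is simulation preorder. For each $(p,q)\in Q\times Q$ there is a plane $P=P_{\langle p,q\rangle}$ (a copy of $\mathbb{R}\times\mathbb{R}$, with first coordinate $m$ horizontal, second coordinate $n$ vertical); a point $(m,n)\in\mathbb{N}^2$ is black in $P$ if $p(m)\preceq q(n)$ and white otherwise. The frontier function $f_P(n)$ is $\infty$ if $p(m)\preceq q(n)$ for all $m$, $-1$ if $p(0)\not\preceq q(n)$, and $\max\{m\mid p(m)\preceq q(n)\}$ otherwise. $HF$ is the set of planes with $f_P(n)=\infty$ for some $n$; $VF$ is the set of planes not in $HF$ with $f_P$ bounded by a constant; $SF$ the remaining planes. A line $\ell$ with slope $\alpha\in\mathbb{R}\setminus\{0\}$ is $\ell(x)=\alpha x+c$ with inverse $\ell^{-1}$; horizontal lines have slope $0$; vertical lines have slope $\infty$ and are given by $\ell^{-1}(y)=c$. The signed distance $\mathrm{dist}((m,n),\ell)$ is the Euclidean distance, taken negative if $(m,n)$ lies to the left of $\ell$ (i.e. $m<\ell^{-1}(n)$). It is known that for each $P\in SF$ there is a unique $\alpha_P\in\mathbb{Q}_+$ such that the distances of the frontier points $(f_P(n),n)$ from the line $\ell_P(x)=\alpha_P x$ are bounded. For $P\in HF$ put $\alpha_P=0$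 and $\ell_P$ the horizontal axis; for $P\in VF$ put $\alpha_P=\infty$ and $\ell_P$ the vertical axis ($\ell_P^{-1}(y)=0$). For $P\in VF\cup SF$: $\mathrm{mind}(P)=\min\{r\mid r=\mathrm{dist}((f_P(n),n),\ell_P)$ for infinitely many $n\}$, $\mathrm{maxd}(P)=\max\{r\mid r=\mathrm{dist}((f_P(n),n),\ell_P)$ for infinitely many $n\}$; for $P\in HF$: $\mathrm{mind}(P)=\mathrm{maxd}(P)=-\min\{n\mid f_P(n)=\infty\}$; $\mathrm{spand}(P)=\mathrm{maxd}(P)-\mathrm{mind}(P)$. Preorders (with $\infty$ greater than every rational): $P\leq_L P'$ iff $\alpha_P>\alpha_{P'}$, or $\alpha_P=\alpha_{P'}$ and $\mathrm{mind}(P)\leq\mathrm{mind}(P')$; $P\leq_R P'$ iff $\alpha_P<\alpha_{P'}$, or $\alpha_P=\alpha_{P'}$ and $\mathrm{maxd}(P)\geq\mathrm{maxd}(P')$; $\approx_L,\approx_R$ are the induced equivalences. For a slope $\alpha$: $\mathcal{P}(\alpha)=\{P\mid\alpha_P=\alpha\}$, and $\mathcal{P}_{ms}(\alpha)$ is the set of $P\in\mathcal{P}(\alpha)$ with maximal $\mathrm{spand}(P)$ in $\mathcal{P}(\alpha)$. For $\alpha\in\mathbb{Q}_+$, $\mathrm{step}(\alpha)=1+1/\alpha$. For a line $\ell$ of slope $\alpha\in\mathbb{Q}_+$ and $k\in\mathbb{N}$: $\mathrm{rnb}_k(\ell)=\{(m,n)\in\mathbb{N}^2\mid \ell^{-1}(n)+(k-1)\mathrm{step}(\alpha)<m\leq\ell^{-1}(n)+k\,\mathrm{step}(\alpha)\}$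 and $\mathrm{lnb}_k(\ell)=\{(m,n)\in\mathbb{N}^2\mid \ell^{-1}(n)-k\,\mathrm{step}(\alpha)\leq m<\ell^{-1}(n)-(k-1)\mathrm{step}(\alpha)\}$. For a vertical line $\ell$: $\mathrm{rnb}_k(\ell)=\{(m,n)\in\mathbb{N}^2\mid\ell^{-1}(n)+(k-1)<m\leq\ell^{-1}(n)+k\}$. For a horizontal line $\ell$: $\mathrm{lnb}_k(\ell)=\{(m,n)\in\mathbb{N}^2\mid\ell(m)+(k-1)<n\leq\ell(m)+k\}$. *)

(* Defs.v *)
(* MathComp / MathComp-Analysis *)
From HB Require Import structures.
From mathcomp Require Import all_boot all_order all_algebra.
From mathcomp Require Import boolp classical_sets cardinality reals.
From mathcomp Require Import constructive_ereal.

Set Implicit Arguments.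
Unset Strict Implicit.
Unset Printing Implicit Defensive.

Import Order.TTheory GRing.Theory Num.Theory.

Local Open Scope ring_scope.

(* Least and greatest element of a set; [x0] is a dummy value, returned only
   when the set has no such element. *)
Definition set_max (d : Order.disp_t) (T : porderType d) (x0 : T) (A : set T)
  : T := xget x0 (A `&` ubound A)%classic.

Definition set_min (d : Order.disp_t) (T : porderType d) (x0 : T) (A : set T)
  : T := xget x0 (A `&` lbound A)%classic.

Section OneCounterNets.

Variables (Q Act : finType).

Record ocn := OCN {
  rules : {pred Q * Act * int * Q};
  rules_effect : forall p a d q,
    (p, a, d, q) \in rules -> d \in ([:: -1; 0; 1] : seq int) }.

Definition config := (Q * nat)%type.

Definition plane := (Q * Q)%type.

Variable N : ocn.

Definition step_rel (s : config) (a : Act) (t : config) : Prop :=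
  (s.1, a, t.2%:Z - s.2%:Z, t.1) \in rules N.

Definition simulation (S : config -> config -> Prop) : Prop :=
  forall s t, S s t -> forall a s', step_rel s a s' ->
    exists2 t', step_rel t a t' & S s' t'.

Definition simulated (s t : config) : Prop :=
  exists2 S, simulation S & S s t.

Definition black (P : plane) (m n : nat) : Prop :=
  simulated (P.1, m) (P.2, n).

Definition white (P : plane) (m n : nat) : Prop := ~ black P m n.

Definition frontier (P : plane) (n : nat) : \bar int :=
  if `[< forall m, black P m n >] then +oo%E
  else if `[< white P 0 n >] then (-1)%:E
  else (set_max 0%N [set m | black P m n]%classic)%:Z%:E.

Definition HF : {set plane} :=
  [set P | `[< exists n, frontier P n = +oo%E >]].

Definition VF : {set plane} :=
  [set P | (P \notin HF)
         & `[< exists c : int, forall n, (frontier P n <= c%:E)%E >]].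

Definition SF : {set plane} := ~: (HF :|: VF).

End OneCounterNets.

Section Lines.

Variable R : realType.

(* [Graph a c] is the line y = a x + c (horizontal when a = 0), and
   [Vertical c] is the line x = c. *)
Inductive line := Graph of R & R | Vertical of R.

Definition on_line (l : line) : set (R * R) :=
  match l with
  | Graph a c => [set z | z.2 = a * z.1 + c]%classic
  | Vertical c => [set z | z.1 = c]%classic
  end.

(* Meaningful for non-vertical lines only. *)
Definition line_fun (l : line) (x : R) : R :=
  match l with Graph a c => a * x + c | Vertical _ => 0 end.

(* Meaningful for non-horizontal lines only. *)
Definition line_inv (l : line) (y : R) : R :=
  match l with Graph a c => (y - c) / a | Vertical c => c end.

Definition eucl (z w : R * R) : R :=
  Num.sqrt ((z.1 - w.1) ^+ 2 + (z.2 - w.2) ^+ 2).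

(* Signed distance, for non-horizontal lines. *)
Definition dist (z : R * R) (l : line) : R :=
  let d := inf [set eucl z w | w in on_line l]%classic in
  if z.1 < line_inv l z.2 then - d else d.

Definition step (a : R) : R := 1 + a^-1.

(* Right neighbourhoods are meaningful for lines of positive or infinite slope,
   left neighbourhoods for lines of positive or zero slope. *)
Definition rnb (k : nat) (l : line) : set (nat * nat) :=
  let s := match l with Graph a _ => step a | Vertical _ => 1 end in
  [set z | line_inv l z.2%:R + (k%:R - 1) * s < z.1%:R
             <= line_inv l z.2%:R + k%:R * s]%classic.

Definition lnb (k : nat) (l : line) : set (nat * nat) :=
  match l with
  | Graph a _ =>
      if a == 0 then
        [set z | line_fun l z.1%:R + (k%:R - 1) < z.2%:R
                   <= line_fun l z.1%:R + k%:R]%classic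
      else
        [set z | line_inv l z.2%:R - k%:R * step a <= z.1%:R
                   < line_inv l z.2%:R - (k%:R - 1) * step a]%classic
  | Vertical _ => set0
  end.

(* The line through the origin with a given, possibly infinite, slope. *)
Definition slope_line (a : \bar rat) : line :=
  if a is b%:E%E then Graph (ratr b) 0 else Vertical 0.

End Lines.

Section Slopes.

Variables (R : realType) (Q Act : finType) (N : ocn Q Act).

Notation plane := (plane Q).

(* [fine] is harmless: frontier values are finite outside [HF]. *)
Definition frontier_dist (P : plane) (l : line R) (n : nat) : R :=
  dist ((fine (frontier N P n))%:~R, n%:R) l.

Definition is_belt_slope (P : plane) (a : rat) : Prop :=
  0 < a /\ exists B : R, forall n,
    `|frontier_dist P (slope_line R a%:E) n| <= B.

(* On [SF] the slope is the unique rational satisfying [is_belt_slope]. *)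
Definition slope (P : plane) : \bar rat :=
  if P \in HF N then 0%:E
  else if P \in VF N then +oo%E
  else (xget 0 [set a | is_belt_slope P a]%classic)%:E.

Definition belt_line (P : plane) : line R := slope_line R (slope P).

Definition recurrent_dists (P : plane) : set R :=
  [set r | infinite_set [set n | r = frontier_dist P (belt_line P) n]]%classic.

Definition HF_height (P : plane) : nat :=
  set_min 0%N [set n | frontier N P n = +oo%E]%classic.

Definition mind (P : plane) : R :=
  if P \in HF N then - (HF_height P)%:R else set_min 0 (recurrent_dists P).

Definition maxd (P : plane) : R :=
  if P \in HF N then - (HF_height P)%:R else set_max 0 (recurrent_dists P).

Definition spand (P : plane) : R := maxd P - mind P.

Definition leL : rel plane := fun P P' =>
  (slope P' < slope P)%E || (slope P == slope P') && (mind P <= mind P').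

Definition leR : rel plane := fun P P' =>
  (slope P < slope P')%E || (slope P == slope P') && (maxd P' <= maxd P).

Definition eqL : rel plane := fun P P' => leL P P' && leL P' P.

Definition eqR : rel plane := fun P P' => leR P P' && leR P' P.

Definition planes_of_slope (a : \bar rat) : {set plane} :=
  [set P | slope P == a].

Definition planes_ms (a : \bar rat) : {set plane} :=
  [set P in planes_of_slope a
     | [forall P' in planes_of_slope a, spand P' <= spand P]].

Definition num_classes (e : rel plane) (s : seq plane) : nat :=
  #|equivalence_partition e [set P in s]|.

(* The index [i] counts from 0, so that sigmaL s i counts the classes
   represented among the first i + 1 planes of s. *)
Definition sigmaL (s : seq plane) (i : nat) : nat :=
  num_classes eqL (take i.+1 s).

Definition sigmaR (s : seq plane) (i : nat) : nat :=
  num_classes eqR (take i.+1 s).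

End Slopes.

(* Main.v *)
(* A direction is a parameter th in [0, 1], and (1 - th) x - th y is the offset of
   the point (x, y) from the ray of slope (1 - th) / th; a neighbourhood has
   width 1 in offsets.

   Every plane has a belt.  For a fixed direction consider the energy game on
   planes in which Duplicator tries to keep the offset bounded.  A gap in the
   range of a least credit function separates the planes where she can from those
   where Spoiler can make the offset drift to infinity.  Sweeping th downwards
   from 1 by real induction, planes won by Duplicator in a less steep direction
   become sinks; in the remaining ones the drift brings Spoiler across the next
   ray, where the plane is already known to be white.  So for each th every plane
   is black above or white below the ray, up to a constant, and its belt lies at
   the supremum of the directions of the first kind.

   Neighbourhoods: an attack from a white point far away on the left border of
   a belt, translated down to the neighbourhood, remains winning, because a step
   changes the offset by at most 1 and the planes entered are either preceding
   ones, or belong to the same belt, or have a belt far away from the original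
   point.  Black points are dealt with by translating Duplicator's strategy.

   Slopes: in a plane of maximal span play an attack at a white point on the left
   border against a defence at a black point on the right border, both sides
   making the same moves.  The play must stay on both borders of planes of maximal
   span, so two visits of the same plane differ by a vector along the belt.

   Polynomial bounds: if no frontier of HF has a corner in some column beyond
   which the other frontiers are out of reach, moving all corners to the right of
   this column by one yields a simulation; so corners leave no holes, and there
   are few of them.  The case of VF is symmetric. *)

Require Import Defs.
From HB Require Import structures.
From mathcomp Require Import all_boot all_order all_algebra.
From mathcomp Require Import zify ring lra.
From mathcomp Require Import boolp classical_sets cardinality reals.
From mathcomp Require Import constructive_ereal.
From mathcomp Require Import Rstruct.

Set Implicit Arguments.
Unset Strict Implicit.
Unset Printing Implicit Defensive.

Import Order.TTheory GRing.Theory Num.Theory.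

Local Open Scope ring_scope.

(** * The simulation game on integer points *)

Section Game.

Variables (Q Act : finType) (N : ocn Q Act).

Implicit Types (P : plane Q) (x y d e : int) (a : Act).

(* Integer coordinates make translations of the plane total. *)
Definition bk P x y := [/\ 0 <= x, 0 <= y & black N P `|x|%N `|y|%N].

Lemma rule_le1 p a d q : (p, a, d, q) \in rules N -> -1 <= d <= 1.
Proof. by move/rules_effect; rewrite !inE => /or3P[] /eqP->. Qed.

Lemma bk_step P x y a d p : bk P x y -> (P.1, a, d, p) \in rules N ->
  0 <= x + d -> exists e q, (P.2, a, e, q) \in rules N /\ bk (p, q) (x + d) (y + e).
Proof.
move=> [x0 y0 [S simS Sxy]] Pd xd0.
have step1 : step_rel N (P.1, `|x|%N) a (p, `|(x + d)%R|%N).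
  by rewrite /step_rel /= !gez0_abs // addrAC subrr add0r.
have [[q n] step2 Sn] := simS _ _ Sxy _ _ step1.
exists (n%:Z - y), q; split; first by move: step2; rewrite /step_rel /= gez0_abs.
have -> : y + (n%:Z - y) = n%:Z by rewrite addrCA subrr addr0.
by split=> [//|//|]; exists S.
Qed.

Lemma bk_coind (S : plane Q -> int -> int -> Prop) :
    (forall P x y, S P x y -> [/\ 0 <= x, 0 <= y &
       forall a d p, (P.1, a, d, p) \in rules N -> 0 <= x + d ->
       exists e q, (P.2, a, e, q) \in rules N /\ S (p, q) (x + d) (y + e)]) ->
  forall P x y, S P x y -> bk P x y.
Proof.
move=> coS P x y Sxy; have [x0 y0 _] := coS _ _ _ Sxy; split => //.
exists (fun s t => S (s.1, t.1) s.2%:Z t.2%:Z); last first.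
  by rewrite /= !gez0_abs //; case: (P) Sxy.
move=> [p m] [q n] /= Smn a [p' m']; rewrite /step_rel /= => Pd.
have [_ _ /(_ a (m'%:Z - m%:Z) p' Pd)] := coS _ _ _ Smn.
rewrite addrCA subrr addr0 => -[//|e [q' [Pe Se]]].
have [_ ne0 _] := coS _ _ _ Se.
exists (q', `|(n%:Z + e)%R|%N); rewrite /= gez0_abs //.
by rewrite addrAC subrr add0r.
Qed.

Lemma bk_mono P x y x' y' : bk P x y -> 0 <= x' -> x' <= x -> y <= y' ->
  bk P x' y'.
Proof.
move=> Pxy x'0 x'x yy'.
pose S P x' y' := exists x y, [/\ bk P x y, 0 <= x', x' <= x & y <= y'].
apply: (@bk_coind S); last by exists x, y.
move=> {P x y x' y' Pxy x'0 x'x yy'} P x' y' [x [y [Pxy x'0 x'x yy']]].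
have [x0 y0 _] := Pxy.
split=> [||a d p Pd xd]; [by [] | by apply: le_trans yy'|].
have [|e [q [Pe Pxy']]] := bk_step Pxy Pd; first by lia.
by exists e, q; split=> //; exists (x + d), (y + e); split=> //; lia.
Qed.

Fixpoint bkn k P x y : Prop :=
  [/\ 0 <= x, 0 <= y &
      if k is k'.+1 then
        forall a d p, (P.1, a, d, p) \in rules N -> 0 <= x + d ->
        exists e q, (P.2, a, e, q) \in rules N /\ bkn k' (p, q) (x + d) (y + e)
      else True].

Lemma bkn_ge0 k P x y : bkn k P x y -> 0 <= x /\ 0 <= y.
Proof. by case: k => [|k] []. Qed.

Lemma bknS k P x y : bkn k.+1 P x y -> bkn k P x y.
Proof.
elim: k P x y => [|k IH] P x y [x0 y0 Pxy]; first by [].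
split=> // a d p Pd xd; have [e [q [Pe /IH Pe']]] := Pxy a d p Pd xd.
by exists e, q.
Qed.

Lemma bkn_le k k' P x y : (k <= k')%N -> bkn k' P x y -> bkn k P x y.
Proof.
by move=> kk'; rewrite -(subnKC kk'); elim: (k' - k)%N => [|i IH];
  rewrite ?addn0 // addnS => /bknS/IH.
Qed.

Lemma bk_bkn k P x y : bk P x y -> bkn k P x y.
Proof.
elim: k P x y => [|k IH] P x y Pxy; have [x0 y0 _] := Pxy; split=> //.
move=> a d p Pd xd; have [e [q [Pe /IH Pe']]] := bk_step Pxy Pd xd.
by exists e, q.
Qed.

(* A response that works for infinitely many approximants works for all, and
   there are only finitely many responses. *)
Lemma bkn_bk P x y : (forall k, bkn k P x y) -> bk P x y.
Proof.
apply: (@bk_coind (fun P x y => forall k, bkn k P x y)) => {}P {}x {}y Pxy.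
have [x0 y0] := bkn_ge0 (Pxy 0%N); split=> // a d p Pd xd.
apply: contrapT => noresp.
have bad (eq : 'I_3 * Q) : exists k, (P.2, a, (eq.1 : nat)%:Z - 1, eq.2) \in rules N ->
    ~ bkn k (p, eq.2) (x + d) (y + ((eq.1 : nat)%:Z - 1)).
  apply: contrapT => /forallNP good; apply: noresp.
  exists ((eq.1 : nat)%:Z - 1), eq.2.
  split=> [|k]; last by apply: contrapT => nk; apply: (good k).
  by apply: contrapT => nk; apply: (good 0%N) => /nk.
have [K badK] := choice bad; pose k := \max_eq K eq.
have [_ _ /(_ a d p Pd xd) [e [q [Pe]]]] := Pxy k.+1.
have /andP[e1 e2] := rule_le1 Pe.
have e3 : (`|(e + 1)%R|%N < 3)%N by lia.
have ee : e = (Ordinal e3 : nat)%:Z - 1 by rewrite /= gez0_abs //; lia.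
move=> /(bkn_le (leq_bigmax (Ordinal e3, q))).
by have := badK (Ordinal e3, q); rewrite -ee /=; apply.
Qed.

Lemma not_bk_bkn P x y : 0 <= x -> 0 <= y -> ~ bk P x y ->
  exists k, ~ bkn k P x y.
Proof.
move=> x0 y0; apply: contra_notP => /forallNP H.
by apply: bkn_bk => k; apply: contrapT.
Qed.

Lemma bkn_attack k P x y : 0 <= x -> 0 <= y -> ~ bkn k P x y ->
  exists2 k', k = k'.+1 & exists a d p, [/\ (P.1, a, d, p) \in rules N, 0 <= x + d &
    forall e q, (P.2, a, e, q) \in rules N -> ~ bkn k' (p, q) (x + d) (y + e)].
Proof.
case: k => [|k] x0 y0 nk; first by case: nk.
exists k => //; apply: contrapT => nS; apply: nk; split=> // a d p Pd xd.
apply: contrapT => nR; apply: nS; exists a, d, p; split=> // e q Pe ke.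
by apply: nR; exists e, q.
Qed.

End Game.

(** * Energy games and belts *)

Section Energy.

Variables (Q Act : finType) (N : ocn Q Act).

(* An energy game on planes: Duplicator tries to keep the sum of the weights
   bounded or to enter [H], Spoiler tries to increase it.  A response function
   [E] of minimal sum is simultaneously a credit function for Duplicator and,
   where it is positive, a credit function for Spoiler; a gap in its range
   separates the two winning regions. *)
Lemma energy_dichotomy (H : {set plane Q}) (w : int -> int -> int) (W : nat) :
    (0 < W)%N ->
    (forall d e, -1 <= d <= 1 -> -1 <= e <= 1 -> - W%:Z <= w d e <= W%:Z) ->
  exists (E : plane Q -> nat) (X : {set plane Q}),
  [/\ forall P, (E P <= (#|{: plane Q}| + 2) * W)%N,
      forall P, P \in X -> forall a d p, (P.1, a, d, p) \in rules N ->
        exists e q, (P.2, a, e, q) \in rules N /\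
          ((p, q) \in H \/ (p, q) \in X /\ (E (p, q))%:Z + w d e <= (E P)%:Z)
    & forall P, P \notin H -> P \notin X ->
        exists a d p, (P.1, a, d, p) \in rules N /\
        forall e q, (P.2, a, e, q) \in rules N ->
          [/\ (p, q) \notin H, (p, q) \notin X &
              (E P)%:Z <= (E (p, q))%:Z + w d e]].
Proof.
move=> W0 wW; set n := #|_|; set L := ((n + 2) * W)%N.
pose good (E : {ffun plane Q -> 'I_L.+1}) := forall P, P \notin H ->
  (E P < L)%N -> forall a d p, (P.1, a, d, p) \in rules N ->
  exists e q, (P.2, a, e, q) \in rules N /\
   ((p, q) \in H \/ (E (p, q))%:Z + w d e <= (E P)%:Z).
have good0 : `[< good [ffun=> ord_max] >].
  by apply/asboolP => P _; rewrite ffunE /= ltnn.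
have [E /asboolP goodE minE] :=
  @arg_minnP _ _ (fun E => `[< good E >]) (fun E => \sum_P E P)%N good0.
have posE P : P \notin H -> (0 < E P)%N ->
    exists a d p, (P.1, a, d, p) \in rules N /\
    forall e q, (P.2, a, e, q) \in rules N ->
      (p, q) \notin H /\ (E P)%:Z <= (E (p, q))%:Z + w d e.
  move=> PH EP0; apply: contrapT => noS.
  have EPL : ((E P).-1 < L.+1)%N by have := ltn_ord (E P); lia.
  pose E' := [ffun P' => if P' == P then Ordinal EPL else E P'].
  have E'E P' : (E' P' <= E P')%N by rewrite ffunE; case: eqP => [->|//]; exact: leq_pred.
  suff /asboolP/minE : good E'.
    apply/negP; rewrite -ltnNge (bigD1 P) // [ltnRHS](bigD1 P) //= -addSn.
    by apply: leq_add; [rewrite ffunE eqxx /= prednK|apply: leq_sum => P' _].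
  move=> P' P'H; rewrite ffunE; case: eqP => [->|_] E'L a d p Pd; last first.
    have [e [q [Pe HE]]] := goodE _ P'H E'L _ _ _ Pd.
    exists e, q; split=> //; case: HE => [|HE]; [by left|right].
    by apply: le_trans HE; rewrite lerD2r lez_nat.
  apply: contrapT => noD; apply: noS; exists a, d, p; split=> // e q Pe.
  split; first by apply/negP => pqH; apply: noD; exists e, q; split=> //; left.
  rewrite leNgt; apply/negP => lt; apply: noD; exists e, q; split=> //; right.
  move: lt (E'E (p, q)) EP0 => /=.
  move: (nat_of_ord (E (p, q))) (nat_of_ord (E' (p, q))) (nat_of_ord (E P)) (w d e).
  lia.
have [j gap] : exists j : 'I_n.+1, forall P, P \notin H ->
    ~ (j * W < E P <= j.+1 * W)%N.
  apply: contrapT => /forallNP nogap.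
  have /choice[f fP] : forall j : 'I_n.+1, exists P,
      P \notin H /\ (j * W < E P <= j.+1 * W)%N.
    move=> j; apply: contrapT => noP; apply: (nogap j) => P PH HP.
    by apply: noP; exists P.
  suff /leq_card : injective f by rewrite card_ord -/n ltnn.
  move=> j k jk; apply/val_inj/eqP.
  have [_ /andP[j1 j2]] := fP j; have [_ /andP[k1 k2]] := fP k.
  rewrite -jk in k1 k2.
  have := leq_trans k1 j2; have := leq_trans j1 k2.
  rewrite !ltn_pmul2r // !ltnS eqn_leq => -> ->; by [].
have jL : (j.+1 * W < L)%N.
  by rewrite /L ltn_pmul2r // addn2 ltnS; apply: ltn_ord.
pose X := [set P | (P \notin H) && (E P <= j * W)%N].
exists (fun P => E P : nat), X; split=> [P|P|P PH].
- by have := ltn_ord (E P).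
- rewrite inE => /andP[PH EPj] a d p Pd.
  have EPL : (E P < L)%N.
    by apply: leq_ltn_trans EPj _; apply: leq_ltn_trans jL; rewrite leq_mul2r leqnSn orbT.
  have [e [q [Pe HE]]] := goodE P PH EPL a d p Pd.
  exists e, q; split=> //.
  have [|pqH] := boolP ((p, q) \in H); [by left|right].
  case: HE => [|HE]; first by rewrite (negPf pqH).
  split=> //; rewrite inE pqH /= leqNgt; apply/negP => lt.
  apply: (gap _ pqH); rewrite lt /= mulSn.
  have := wW d e (rule_le1 Pd) (rule_le1 Pe); move: EPj HE.
  by move: (nat_of_ord (E P)) (nat_of_ord (E (p, q))) (w d e); lia.
- rewrite inE PH /= -ltnNge => lt.
  have EPj : (j.+1 * W < E P)%N.
    by rewrite ltnNge; apply/negP => le; apply: (gap P PH); rewrite lt le.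
  have [a [d [p [Pd HS]]]] := posE P PH (leq_ltn_trans (leq0n _) EPj).
  exists a, d, p; split=> // e q Pe; have [pqH HE] := HS e q Pe.
  split=> //; rewrite inE pqH /= -ltnNge.
  have := wW d e (rule_le1 Pd) (rule_le1 Pe); move: EPj HE; rewrite mulSn.
  by move: (nat_of_ord (E P)) (nat_of_ord (E (p, q))) (w d e); lia.
Qed.

End Energy.

Lemma step_ge0 (x d : int) : 0 < x -> -1 <= d <= 1 -> 0 <= x + d.
Proof. by lia. Qed.

Section Offset.

Variable R : realType.

Implicit Types (th c : R) (x y d e : int).

(* The position of (x, y) relative to the ray from the origin of slope
   (1 - th) / th, scaled so that a neighbourhood step has length 1; th = 0 is
   the vertical axis and th = 1 the horizontal one. *)
Definition off th x y : R := (1 - th) * x%:~R - th * y%:~R.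

Lemma offD th x y d e : off th (x + d) (y + e) = off th x y + off th d e.
Proof. by rewrite /off !rmorphD /=; ring. Qed.

Lemma offB th x y d e : off th (x - d) (y - e) = off th x y - off th d e.
Proof. by rewrite /off !rmorphB /=; ring. Qed.

Lemma off_shift th th' x y : off th x y = off th' x y + (th' - th) * (x + y)%:~R.
Proof. by rewrite /off rmorphD /=; ring. Qed.

Lemma off_bound th (n : nat) x y : 0 <= th <= 1 -> - n%:Z <= x <= n%:Z ->
  - n%:Z <= y <= n%:Z -> - n%:R <= off th x y <= n%:R.
Proof.
move=> th01; rewrite -!(ler_int R) rmorphN /= -!pmulrn /off.
by move: (x%:~R) (y%:~R) (n%:R) => X Y M; nra.
Qed.

Lemma off_step th d e : 0 <= th <= 1 -> -1 <= d <= 1 -> -1 <= e <= 1 ->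
  -1 <= off th d e <= 1.
Proof. exact: (@off_bound th 1%N). Qed.

Lemma step_sum d e : -1 <= d <= 1 -> -1 <= e <= 1 ->
  (d + e)%:~R <= 2 :> R /\ -2 <= (d + e)%:~R :> R.
Proof.
move=> d1 e1; rewrite -[2]/(2%:~R) -rmorphN /= !ler_int; split; lia.
Qed.

Lemma off_gt0 th x y : 0 <= th <= 1 -> 0 <= x -> 0 <= y -> 0 < off th x y -> 0 < x.
Proof.
move=> th01 x0 y0 xy; rewrite lt_neqAle x0 andbT; apply: contraTneq xy => <-.
rewrite -leNgt /off mulr0 sub0r oppr_le0 mulr_ge0 ?ler0z //.
by case/andP: th01.
Qed.

Lemma off_lt0 th x y : 0 <= th <= 1 -> 0 <= x -> 0 <= y -> off th x y < 0 -> 0 < y.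
Proof.
move=> th01 x0 y0 xy; rewrite lt_neqAle y0 andbT; apply: contraTneq xy => <-.
rewrite -leNgt /off mulr0 subr0 mulr_ge0 ?ler0z // subr_ge0.
by case/andP: th01.
Qed.

Lemma off_anti th th' x y : th <= th' -> 0 <= x -> 0 <= y ->
  off th' x y <= off th x y.
Proof.
move=> le x0 y0; rewrite [leRHS](off_shift _ th') lerDl mulr_ge0 ?subr_ge0 //.
by rewrite ler0z addr_ge0.
Qed.

End Offset.

Section Belt.

Variables (R : realType) (Q Act : finType) (N : ocn Q Act).

Implicit Types (th c : R) (P : plane Q) (x y d e : int).

Definition bl c th P :=
  forall x y, 0 <= x -> 0 <= y -> off th x y < - c -> bk N P x y.

Definition wh c th P :=
  forall x y, 0 <= x -> 0 <= y -> c < off th x y -> ~ bk N P x y.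

Definition energy_bound : R := 3 * (#|{: plane Q}| + 2)%:R.

Local Notation C := energy_bound.

Lemma energy_bound_ge0 : 0 <= C. Proof. by rewrite mulr_ge0 ?ler0n. Qed.

Lemma bl_anti c th th' P : th <= th' -> bl c th' P -> bl c th P.
Proof.
move=> le blP x y x0 y0 lt; apply: blP => //.
by apply: le_lt_trans lt; apply: off_anti.
Qed.

Lemma energy_real (g : R) (H : {set plane Q}) (k : nat) : 0 <= g <= 1 ->
  exists EX : (plane Q -> R) * {set plane Q},
  [/\ forall P, 0 <= EX.1 P <= C,
      forall P, P \in EX.2 -> forall a d p, (P.1, a, d, p) \in rules N ->
        exists e q, (P.2, a, e, q) \in rules N /\
          ((p, q) \in H \/ (p, q) \in EX.2 /\
             EX.1 (p, q) + off g d e <= EX.1 P + 2 / k.+1%:R)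
    & forall P, P \notin H -> P \notin EX.2 ->
        exists a d p, (P.1, a, d, p) \in rules N /\
        forall e q, (P.2, a, e, q) \in rules N ->
          [/\ (p, q) \notin H, (p, q) \notin EX.2 &
              EX.1 P + 1 / k.+1%:R <= EX.1 (p, q) + off g d e]].
Proof.
move=> g01; pose s : R := k.+1%:R.
have s1 : 1 <= s by rewrite /s ler1n.
have s0 : 0 < s by apply: lt_le_trans s1.
pose w d e := Num.floor (s * off g d e) - 1.
have wE d e : s * off g d e - 2 <= (w d e)%:~R <= s * off g d e - 1.
  rewrite /w rmorphB /=; have := floor_itv (s * off g d e).
  by rewrite rmorphD /=; move: (_%:~R) => F /andP[]; lra.
have [||E [X [EL HX HY]]] := @energy_dichotomy _ _ N H w k.+3.
- by [].
- move=> d e d1 e1; have := wE d e; have := off_step g01 d1 e1.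
  rewrite -!(ler_int R) rmorphN /= -[k.+3%:~R]/(k.+3%:R) -[k.+3%:R]natr1 -[k.+2%:R]natr1 -/s.
  by move: (off _ _ _) (_%:~R) => o F; nra.
exists (fun P => (E P)%:R / s, X); split=> /= [P|P PX a d p Pd|P PH PX].
- rewrite divr_ge0 ?ler0n //=.
  rewrite ler_pdivrMr // /energy_bound; have := EL P; rewrite -(ler_nat R) natrM => le.
  apply: (le_trans le); rewrite -mulrA mulrCA ler_wpM2l ?ler0n //.
  by rewrite -natr1 -[k.+2%:R]natr1 -/s; lra.
- have [e [q [Pe HE]]] := HX P PX a d p Pd; exists e, q; split=> //.
  case: HE => [|[pqX HE]]; [by left|right; split=> //].
  have := wE d e; move: HE; rewrite -(ler_int R) rmorphD /= -!pmulrn.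
  move: (off g d e) (_%:~R) => o F HE FE.
  by rewrite -(ler_pM2r s0) !mulrDl !divfK ?gt_eqF // [o * s]mulrC; lra.
- have [a [d [p [Pd HE]]]] := HY P PH PX; exists a, d, p; split=> // e q Pe.
  have [pqH pqX {}HE] := HE e q Pe; split=> //.
  have := wE d e; move: HE; rewrite -(ler_int R) rmorphD /= -!pmulrn.
  move: (off g d e) (_%:~R) => o F HE FE.
  by rewrite -(ler_pM2r s0) !mulrDl !divfK ?gt_eqF // [o * s]mulrC; lra.
Qed.

Lemma duplicator_holds (g cH : R) (H : {set plane Q})
    (EX : nat -> (plane Q -> R) * {set plane Q}) :
    0 <= g <= 1 -> 0 <= cH -> (forall P, P \in H -> bl cH g P) ->
    (forall k P, 0 <= (EX k).1 P <= C) ->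
    (forall k P, P \in (EX k).2 -> forall a d p, (P.1, a, d, p) \in rules N ->
        exists e q, (P.2, a, e, q) \in rules N /\
          ((p, q) \in H \/ (p, q) \in (EX k).2 /\
             (EX k).1 (p, q) + off g d e <= (EX k).1 P + 2 / k.+1%:R)) ->
  forall P, (forall k, P \in (EX k).2) -> bl (cH + C + 2) g P.
Proof.
move=> g01 cH0 blH EC HX P PX x y x0 y0 xy; apply: bkn_bk => n.
pose k := (2 * n)%N; pose E := (EX k).1; pose X := (EX k).2; pose s : R := 2 / k.+1%:R.
have s0 : 0 < s by rewrite divr_gt0.
have ns : n%:R * s <= 1.
  by rewrite /s mulrA ler_pdivrMr // mul1r -natrM mulnC ler_nat leqnSn.
suff holds j P' x' y' : P' \in X -> 0 <= x' -> 0 <= y' ->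
    off g x' y' + E P' + j%:R * s < - cH - 1 -> bkn N j P' x' y'.
  apply: holds => //; first exact: PX.
  by have := EC k P; rewrite -/E; move: xy; lra.
elim: j P' x' y' => [|j IH] P' x' y' P'X x'0 y'0 lt; split=> // a d p Pd xd.
have E0 : 0 <= E P' by have /andP[] := EC k P'.
have js : 0 <= j%:R * s by rewrite mulr_ge0 // ltW.
have lt' : off g x' y' + E P' + j%:R * s + s < - cH - 1.
  by move: lt; rewrite -natr1 mulrDl mul1r addrA.
have y'1 : 0 < y' by apply: (off_lt0 g01 x'0) => //; lra.
have [e [q [Pe HE]]] := HX k P' P'X a d p Pd; exists e, q; split=> //.
have ye := step_ge0 y'1 (rule_le1 Pe).
have [pqH|[pqX {}HE]] := HE.
  apply: bk_bkn; apply: blH => //; rewrite offD.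
  have := off_step g01 (rule_le1 Pd) (rule_le1 Pe).
  by move: (off _ d e) (off _ x' y') lt' => o1 o2; lra.
apply: IH => //; rewrite offD.
move: HE; rewrite -/E -/s.
by move: (off _ d e) (off _ x' y') (E _) (E _) lt' => o1 o2 E1 E2; lra.
Qed.

Lemma spoiler_drifts (Y : plane Q -> Prop) (E : plane Q -> R) (c g th eps eta : R) :
    0 < eps -> 0 <= c -> 0 <= th -> g - eta <= th <= g -> g <= 1 -> 8 * eta <= eps ->
    (forall P, 0 <= E P <= c) ->
    (forall P, Y P -> exists a d p, (P.1, a, d, p) \in rules N /\
        forall e q, (P.2, a, e, q) \in rules N ->
          Y (p, q) /\ E P + eps <= E (p, q) + off g d e) ->
    (forall P, Y P -> wh c (g + eta) P) ->
  forall P, Y P -> wh c th P.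
Proof.
move=> eps0 c0 th0 gth g1 etaeps EC HY whY P0 YP0 x0 y0 x00 y00 cxy bk0.
have th01 : 0 <= th <= 1 by lra.
have eta0 : 0 <= eta by lra.
have run t : exists P x y, [/\ Y P, bk N P x y,
    off th x0 y0 + E P0 + t%:R * (eps - 2 * eta) <= off th x y + E P &
    (x + y)%:~R <= (x0 + y0)%:~R + 2 * t%:R :> R].
  elim: t => [|t [P [x [y [YP Pxy le1 le2]]]]].
    by exists P0, x0, y0; split=> //; rewrite ?mulr0 ?mul0r ?addr0.
  have [x1 y1 _] := Pxy.
  have tt : 0 <= t%:R * (eps - 2 * eta) by rewrite mulr_ge0 //; lra.
  have xgt0 : 0 < x.
    apply: (off_gt0 th01 x1 y1).
    by have := EC P; have := EC P0; move: le1 tt cxy; lra.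
  have [a [d [p [Pd Pw]]]] := HY P YP.
  have xd := step_ge0 xgt0 (rule_le1 Pd).
  have [e [q [Pe Pxy']]] := bk_step Pxy Pd xd.
  have [Ypq le3] := Pw e q Pe.
  have [de2 de2'] := step_sum R (rule_le1 Pd) (rule_le1 Pe).
  exists (p, q), (x + d), (y + e); split=> //.
    rewrite offD [off th d e](off_shift _ g) -natr1.
    move: le1 le3 de2 de2'; move: ((d + e)%:~R) (off _ d e) => s o le1 le3 s1 s2.
    have : - (2 * eta) <= (g - th) * s by nra.
    by lra.
  rewrite addrACA rmorphD /= -natr1; move: le2 de2; move: ((d + e)%:~R) (_%:~R) => s s'.
  by lra.
pose b := 2 * c + 2 * eta * (x0 + y0)%:~R.
have [t bt] : exists t : nat, b < t%:R * (eps / 4).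
  exists (Num.truncn (b / (eps / 4))).+1.
  by rewrite -ltr_pdivrMr ?divr_gt0 // truncnS_gt.
have [P [x [y [YP Pxy le1 le2]]]] := run t; have [x1 y1 _] := Pxy.
apply: (whY P YP x y) => //.
rewrite (off_shift _ th).
have xy0 : (0 : R) <= (x + y)%:~R by rewrite ler0z addr_ge0.
have tR : (0 : R) <= t%:R by [].
have : (g + eta - th) * (x + y)%:~R <= 2 * eta * (x + y)%:~R.
  by rewrite ler_wpM2r //; lra.
have : 2 * eta * (x + y)%:~R <= 2 * eta * ((x0 + y0)%:~R + 2 * t%:R).
  by rewrite ler_wpM2l // mulr_ge0.
have : t%:R * (eps / 4) + 4 * eta * t%:R <= t%:R * (eps - 2 * eta).
  have : 0 <= t%:R * (eps - 8 * eta) by rewrite mulr_ge0 //; lra.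
  by lra.
have := EC P; have := EC P0; move: bt le1 le2 cxy; rewrite /b.
move: ((x + y)%:~R) ((x0 + y0)%:~R) (off _ _ _) (off _ _ _) => s s0 o o0.
by lra.
Qed.

Definition settled th := forall P, (exists c, bl c th P) \/ wh C th P.

Lemma settled_ge1 th : 1 <= th -> settled th.
Proof.
move=> th1 P; right=> x y x0 y0; rewrite ltNge => /negP[]; apply: le_trans energy_bound_ge0.
rewrite /off subr_le0; apply: (@le_trans _ _ 0).
  by rewrite mulr_le0_ge0 ?ler0z // subr_le0.
by rewrite mulr_ge0 ?ler0z // (le_trans ler01).
Qed.

(* Planes with a black region below some ray of parameter th' > g are winning
   sinks for Duplicator in the energy game of direction g; all other planes are
   white right of the rays of parameter slightly above g, which a drifting
   Spoiler reaches. *)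
Lemma settled_step g : 0 <= g <= 1 -> (forall th, g < th -> settled th) ->
  exists2 eta, 0 < eta & forall P, (exists c, bl c g P) \/
    forall th, 0 <= th -> g - eta <= th <= g -> wh C th P.
Proof.
move=> g01 above.
pose H := [set P | `[< exists th c, g < th /\ bl c th P >]].
have /choice[ch chP] : forall P, exists c, P \in H -> bl c g P.
  move=> P; have [|PH] := boolP (P \in H); last by exists 0.
  rewrite inE => /asboolP[th [c [/ltW gth /(bl_anti gth) blP]]].
  by exists c.
pose cH := \sum_P `|ch P|.
have blH P : P \in H -> bl cH g P.
  move=> PH x y x0 y0 lt; apply: (chP P PH) => //; apply: (lt_le_trans lt).
  rewrite lerN2 /cH (bigD1 P) //= (le_trans (ler_norm _)) // lerDl.
  by apply: sumr_ge0.
have cH0 : 0 <= cH by apply: sumr_ge0.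
have /choice[EX EXP] := fun k => energy_real H k g01.
have /choice[k kP] : forall P, exists k : nat,
    (forall k, P \in (EX k).2) \/ P \notin (EX k).2.
  move=> P; have [|/existsNP[k kP]] := EM (forall k, P \in (EX k).2).
    by exists 0%N; left.
  by exists k; right; apply/negP.
pose K := \max_P k P.
exists (1 / (8 * K.+1%:R)) => [|P]; first by rewrite divr_gt0 // mulr_gt0.
have [PH|PH] := boolP (P \in H); first by left; exists cH; apply: blH.
have [PX|PX] := kP P.
  left; exists (cH + C + 2); apply: (@duplicator_holds g cH H EX) => //.
    by move=> j P'; have [] := EXP j.
  by move=> j P'; have [_ + _] := EXP j; apply.
right=> th th0 thg; have [EC _ HY] := EXP (k P).
set eta := 1 / _ in thg.
have eta0 : 0 < eta by rewrite divr_gt0 // mulr_gt0.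
apply: (@spoiler_drifts (fun P' => P' \notin H /\ P' \notin (EX (k P)).2)
  (EX (k P)).1 C g th (1 / (k P).+1%:R) eta) => //.
- by rewrite divr_gt0.
- exact: energy_bound_ge0.
- by case/andP: g01.
- have K0 : K.+1%:R != 0 :> R by rewrite pnatr_eq0.
  have -> : 8 * eta = K.+1%:R^-1 by rewrite /eta div1r invfM mulrA divff ?mul1r // pnatr_eq0.
  rewrite div1r lef_pV2 ?posrE // ler_nat ltnS.
  exact: leq_bigmax.
- move=> P' [P'H P'X]; have [a [d [p [Pd HE]]]] := HY P' P'H P'X.
  by exists a, d, p; split=> // e q /HE[].
- move=> P' [P'H _]; have [|[c blP']|//] := above (g + eta) _ P'.
    by rewrite ltrDl.
  case/negP: P'H; rewrite inE; apply/asboolP; exists (g + eta), c.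
  by rewrite ltrDl.
Qed.

End Belt.

Section BeltExists.

Variables (R : realType) (Q Act : finType) (N : ocn Q Act).

Implicit Types (th c : R) (P : plane Q) (x y d e : int).

Local Notation C := (energy_bound R Q).
Local Notation settled := (settled N).
Local Notation bl := (bl N).
Local Notation wh := (wh N).

Lemma all_settled th : 0 <= th -> settled th.
Proof.
move=> th0; apply: contrapT => nth.
pose A := [set t : R | 0 <= t <= 1 /\ ~ settled t]%classic.
have A1 (t : R) : ~ settled t -> t < 1.
  by move=> nt; rewrite ltNge; apply/negP => /settled_ge1.
have supA : has_sup A.
  split; first by exists th; split=> //; rewrite th0 ltW // A1.
  by exists 1 => t [/andP[]].
have g0 : 0 <= sup A.
  apply: (le_trans th0); apply: ub_le_sup; first by case: supA.
  by split=> //; rewrite th0 ltW // A1.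
have g1 : sup A <= 1 by apply: ge_sup; [case: supA|move=> t [/andP[]]].
have above (t : R) : sup A < t -> settled t.
  move=> lt; apply: contrapT => nt; have t0 := le_trans g0 (ltW lt).
  move: lt; rewrite ltNge => /negP[]; apply: ub_le_sup; first by case: supA.
  by split=> //; rewrite t0 ltW // A1.
have [|eta eta0 Heta] := settled_step _ above; first by rewrite g0.
have [t At gt] := sup_adherent eta0 supA.
have tg : t <= sup A by apply: ub_le_sup => //; case: supA.
have [/andP[t0 t1] nt] := At.
apply: nt => P; have [[c blP]|whP] := Heta P; [left|right].
  by exists c; apply: bl_anti blP.
by apply: whP => //; rewrite ltW.
Qed.

Lemma belt P : exists th c, [/\ 0 <= th <= 1, 0 <= c, bl c th P & wh c th P].
Proof.
pose A := [set t : R | 0 <= t <= 1 /\ exists c, bl c t P]%classic.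
have A0 : A 0.
  split; first by rewrite lexx ler01.
  exists 0 => x y x0 y0; rewrite /off subr0 mul1r mul0r subr0 oppr0 ltNge.
  by rewrite ler0z x0.
have supA : has_sup A by split; [exists 0|exists 1 => t [/andP[]]].
have g0 : 0 <= sup A by apply: ub_le_sup => //; case: supA.
have g1 : sup A <= 1 by apply: ge_sup; [case: supA|move=> t [/andP[]]].
have above (t : R) : sup A < t -> wh C t P.
  move=> lt; have t0 : 0 <= t by apply: le_trans g0 (ltW lt).
  have [t1|/ltW t1] := leP t 1; last first.
    move=> x y x0 y0; rewrite ltNge => /negP[].
    apply: le_trans (energy_bound_ge0 R Q); apply: (le_trans (off_anti t1 x0 y0)).
    by rewrite /off subrr mul0r mul1r sub0r oppr_le0 ler0z.
  have [[c blP]|//] := all_settled t0 P.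
  move: lt; rewrite ltNge => /negP[]; apply: ub_le_sup; first by case: supA.
  by split; [rewrite t0|exists c].
have g01 : 0 <= sup A <= 1 by rewrite g0.
have [eta eta0 /(_ P)] := settled_step g01 (fun t lt => @all_settled t (le_trans g0 (ltW lt))).
case=> [[c blP]|whP].
  exists (sup A), (Num.max C c); split=> //.
  - by rewrite le_max energy_bound_ge0.
  - move=> x y x0 y0 lt; apply: blP => //; apply: (lt_le_trans lt).
    by rewrite lerN2 le_max lexx orbT.
  - move=> x y x0 y0; rewrite gt_max => /andP[lt _].
    have s1 : 0 < ((x + y)%:~R + 1 : R) by rewrite ltr_wpDl // ler0z addr_ge0.
    pose d := (off (sup A) x y - C) / (2 * ((x + y)%:~R + 1)).
    have d0 : 0 < d by rewrite divr_gt0 ?subr_gt0 ?mulr_gt0.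
    apply: (above (sup A + d)) => //; first by rewrite ltrDl.
    rewrite (off_shift _ (sup A)) opprD addrA subrr sub0r mulNr ltrBrDr -ltrBrDl.
    rewrite /d mulrAC ltr_pdivrMr ?mulr_gt0 // ltr_pM2l ?subr_gt0 //.
    by lra.
have [t At gt] := sup_adherent eta0 supA.
have tg : t <= sup A by apply: ub_le_sup => //; case: supA.
have [/andP[t0 t1] [c blP]] := At.
exists t, (Num.max C c); split=> //.
- by rewrite t0.
- by rewrite le_max energy_bound_ge0.
- move=> x y x0 y0 lt; apply: blP => //; apply: (lt_le_trans lt).
  by rewrite lerN2 le_max lexx orbT.
- move=> x y x0 y0; rewrite gt_max => /andP[lt _]; apply: whP lt => //.
  by rewrite tg ltW.
Qed.

End BeltExists.

(** * Neighbourhoods *)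

Lemma uniform_nat (T : finType) (p : T -> nat -> Prop) :
    (forall t n m, (n <= m)%N -> p t n -> p t m) -> (forall t, exists n, p t n) ->
  exists n, forall t, p t n.
Proof.
move=> mono /choice[n np]; exists (\max_t n t) => t.
by apply: mono (np t); apply: leq_bigmax.
Qed.

Section Limits.

Variable R : realType.

Lemma archi_lt (r s : R) : 0 < s -> exists n : nat, r < s * n%:R.
Proof.
move=> s0; exists (Num.truncn (r / s)).+1.
by rewrite mulrC -ltr_pdivrMr // truncnS_gt.
Qed.

Lemma liminf_exists (S : int -> R -> Prop) (B M : R) :
    (forall k k' v, k <= k' -> S k' v -> S k v) ->
    (forall v, S 0 v -> B <= v) -> (forall k, exists2 v, S k v & v <= M) ->
  exists mu, (forall eta, 0 < eta -> exists k, forall v, S k v -> mu - eta <= v) /\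
             (forall eta k, 0 < eta -> exists2 v, S k v & v <= mu + eta).
Proof.
move=> mono lower upper.
pose A := [set r : R | exists k, forall v, S k v -> r <= v]%classic.
have supA : has_sup A.
  split; first by exists B, 0.
  exists M => r [k rk]; have [v Sv vM] := upper k.
  exact: le_trans (rk v Sv) vM.
exists (sup A); split=> [eta eta0|eta k eta0].
  have [r [k rk] lt] := sup_adherent eta0 supA.
  by exists k => v /rk; apply: le_trans; apply: ltW.
apply: contrapT => noV; suff : sup A + eta <= sup A by lra.
apply: ub_le_sup; first by case: supA.
exists k => v Sv; rewrite leNgt; apply/negP => lt; apply: noV.
by exists v => //; apply: ltW.
Qed.

End Limits.

Section Limit_offsets.

Variables (R : realType) (Q Act : finType) (N : ocn Q Act).

Implicit Types (th c : R) (P : plane Q) (x y d e k : int).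

Local Notation bk := (bk N).
Local Notation bl := (bl N).
Local Notation wh := (wh N).

Definition belted th c P := [/\ 0 <= th <= 1, 0 <= c, bl c th P & wh c th P].

Definition white_liminf th P (mu : R) :=
  (forall eta, 0 < eta -> exists k, forall x y, 0 <= x -> 0 <= y -> k <= y ->
     ~ bk P x y -> mu - eta <= off th x y) /\
  (forall eta k, 0 < eta -> exists x y, [/\ 0 <= x, 0 <= y, k <= y, ~ bk P x y &
     off th x y <= mu + eta]).

Definition black_limsup th P (nu : R) :=
  (forall eta, 0 < eta -> exists k, forall x y, k <= x -> bk P x y ->
     off th x y <= nu + eta) /\
  (forall eta k, 0 < eta -> exists x y, [/\ k <= x, bk P x y &
     nu - eta <= off th x y]).

Lemma bk_off_le th c P x y : wh c th P -> bk P x y -> off th x y <= c.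
Proof.
move=> whP Pxy; have [x0 y0 _] := Pxy.
by rewrite leNgt; apply/negP => /(whP _ _ x0 y0).
Qed.

Lemma wh_off_ge th c P x y : bl c th P -> 0 <= x -> 0 <= y -> ~ bk P x y ->
  - c <= off th x y.
Proof.
by move=> blP x0 y0 nP; rewrite leNgt; apply/negP => /(blP _ _ x0 y0).
Qed.

Lemma white_liminf_exists th c P : belted th c P -> th < 1 ->
  exists mu, white_liminf th P mu.
Proof.
move=> [/andP[th0 _] c0 blP whP] th1.
pose S k (v : R) := exists x y, [/\ 0 <= x, 0 <= y, k <= y, ~ bk P x y & v = off th x y].
have [||k|mu [lower upper]] := @liminf_exists _ S (- c) (c + 1).
- move=> k k' v kk' [x [y [x0 y0 k'y nP ->]]].
  by exists x, y; split=> //; apply: le_trans k'y.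
- by move=> _ [x [y [x0 y0 _ nP ->]]]; apply: wh_off_ge nP.
- pose y := Num.max k 0; pose r := (c + th * y%:~R) / (1 - th).
  have y0 : 0 <= y by rewrite le_max lexx orbT.
  have r0 : 0 <= r.
    by apply: divr_ge0; [rewrite addr_ge0 // mulr_ge0 // ler0z|rewrite subr_ge0 ltW].
  have rE : (1 - th) * r = c + th * y%:~R by rewrite mulrC divfK // gt_eqF ?subr_gt0.
  have := floor_itv r; rewrite rmorphD /= => /andP[f1 f2].
  have x0 : 0 <= Num.floor r + 1 by rewrite addr_ge0 // floor_ge0.
  have lb : (1 - th) * r < (1 - th) * ((Num.floor r)%:~R + 1).
    by rewrite ltr_pM2l // subr_gt0.
  have ub : (1 - th) * (Num.floor r)%:~R <= (1 - th) * r.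
    by rewrite ler_wpM2l // subr_ge0 ltW.
  exists (off th (Num.floor r + 1) y).
    exists (Num.floor r + 1), y; split=> //; first by rewrite le_max lexx.
    by apply: whP => //; rewrite /off rmorphD /=; lra.
  by rewrite /off rmorphD /=; lra.
exists mu; split=> [eta /lower[k Hk]|eta k /(upper eta k)].
  by exists k => x y x0 y0 ky nP; apply: Hk; exists x, y.
by move=> [_ [x [y [x0 y0 ky nP ->]]] le]; exists x, y.
Qed.

Lemma black_limsup_exists th c P : belted th c P -> 0 < th ->
  exists nu, black_limsup th P nu.
Proof.
move=> [/andP[_ th1] c0 blP whP] th0.
pose S k (v : R) := exists x y, [/\ k <= x, bk P x y & v = - off th x y].
have [||k|mu [lower upper]] := @liminf_exists _ S (- c) (c + 1).
- move=> k k' v kk' [x [y [k'x Pxy ->]]].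
  by exists x, y; split=> //; apply: le_trans k'x.
- by move=> _ [x [y [_ Pxy ->]]]; rewrite lerN2; apply: bk_off_le Pxy.
- pose x := Num.max k 0; pose r := (c + (1 - th) * x%:~R) / th.
  have x0 : 0 <= x by rewrite le_max lexx orbT.
  have r0 : 0 <= r.
    by rewrite divr_ge0 ?(ltW th0) // addr_ge0 // mulr_ge0 ?subr_ge0 ?ler0z.
  have rE : th * r = c + (1 - th) * x%:~R by rewrite mulrC divfK // gt_eqF.
  have := floor_itv r; rewrite rmorphD /= => /andP[f1 f2].
  have y0 : 0 <= Num.floor r + 1 by rewrite addr_ge0 // floor_ge0.
  have lb : th * r < th * ((Num.floor r)%:~R + 1) by rewrite ltr_pM2l.
  have ub : th * (Num.floor r)%:~R <= th * r by rewrite ler_wpM2l // ltW.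
  exists (- off th x (Num.floor r + 1)).
    exists x, (Num.floor r + 1); split=> //; first by rewrite le_max lexx.
    by apply: blP => //; rewrite /off rmorphD /=; lra.
  by rewrite /off rmorphD /=; lra.
exists (- mu); split=> [eta /lower[k Hk]|eta k /(upper eta k)].
  exists k => x y kx Pxy; rewrite -lerN2 opprD opprK.
  by apply: Hk; exists x, y.
by move=> [_ [x [y [kx Pxy ->]]] le]; exists x, y; split=> //; lra.
Qed.

End Limit_offsets.

Section Neighbourhoods.

Variables (R : realType) (Q Act : finType) (N : ocn Q Act).

Implicit Types (P : plane Q) (x y d e : int).

Local Notation bk := (bk N).

Variables (th c mu nu : plane Q -> R).
Hypothesis thP : forall P, belted N (th P) (c P) P.
Hypothesis muP : forall P, th P < 1 -> white_liminf N (th P) P (mu P).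
Hypothesis nuP : forall P, 0 < th P -> black_limsup N (th P) P (nu P).

Let th01 P : 0 <= th P <= 1. Proof. by case: (thP P). Qed.

(* Translating Spoiler's attack from a white point far away on the left border
   of the belt of [P0] makes it work at every point right of the neighbourhoods
   of the planes that precede [P0]. *)
Lemma white_right P0 (K : nat) : th P0 < 1 -> (0 < K)%N ->
    (forall P, th P < th P0 \/ th P = th P0 /\ mu P < mu P0 ->
      exists2 k : nat, (k < K)%N & forall x y, 0 <= x -> 0 <= y ->
        k%:R - 1 < off (th P) x y -> ~ bk P x y) ->
  forall x y, 0 <= x -> 0 <= y -> K%:R - 1 < off (th P0) x y -> ~ bk P0 x y.
Proof.
move=> th1 K0 prec a b a0 b0; set t0 := th P0 => ab; set o := off _ _ _ in ab.
have K1 : 1 <= K%:R :> R by rewrite ler1n.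
have t01 : 0 <= t0 <= 1 by exact: th01.
pose eta := (o - (K%:R - 1)) / 3.
have eta0 : 0 < eta by rewrite divr_gt0 // subr_gt0.
have etaE : 3 * eta = o - (K%:R - 1) by rewrite mulrC divfK ?pnatr_eq0.
have [n Hn] : exists n : nat, forall P,
    (th P = t0 -> mu P0 <= mu P -> forall x y, 0 <= x -> 0 <= y -> n%:Z <= y ->
       ~ bk P x y -> mu P0 - eta <= off t0 x y) /\
    (t0 < th P -> mu P0 + eta - o + 2 * c P < (th P - t0) * n%:R).
  apply: uniform_nat => [P n m nm [H1 H2]|P].
    split=> [e le x y x0 y0 my|lt].
      by apply: H1 => //; apply: le_trans my; rewrite lez_nat.
    by apply: (lt_le_trans (H2 lt)); rewrite ler_pM2l ?ler_nat // subr_gt0.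
  case: (ltgtP t0 (th P)) => [lt|gt|e].
  - have [|n Hn] := @archi_lt _ (mu P0 + eta - o + 2 * c P) (th P - t0).
      by rewrite subr_gt0.
    by exists n; split=> // e; rewrite e ltxx in lt.
  - by exists 0%N; split=> // e; rewrite e ltxx in gt.
  - have [|lower _] := muP (P := P); first by rewrite -e.
    have [k Hk] := lower _ eta0; exists `|k|%N; split=> // _ le x y x0 y0 ny nP.
    rewrite e; apply: (le_trans (lerB le (lexx _))); apply: Hk => //.
    by apply: le_trans ny; exact: lez_abs.
have [_ upper] := muP th1.
have [X [Y [X0 Y0 nY nXY oXY]]] := upper eta (n%:Z + b) eta0.
have [Xa|aX] := leP X a.
  move=> bab; apply: nXY; apply: (bk_mono bab) => //.
  by apply: le_trans nY; rewrite lerDr.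
pose dx := X - a; pose dy := Y - b.
have dx0 : 0 <= dx by rewrite subr_ge0 ltW.
have ndy : n%:Z <= dy by rewrite lerBrDr.
have dy0 : 0 <= dy by apply: le_trans ndy.
have offV : off t0 dx dy <= mu P0 + eta - o.
  by rewrite /dx /dy offB; move: oXY; rewrite -/t0 -/o; lra.
have real_white k P x y : dx <= x -> dy <= y -> th P = t0 -> mu P0 <= mu P ->
    ~ bkn N k P x y -> ~ bk P (x - dx) (y - dy).
  elim: k P x y => [|k IH] P x y dxx dyy tP mP nk rP.
    apply: nk; split=> //; [exact: le_trans dxx | exact: le_trans dyy].
  have [x0 y0] : 0 <= x /\ 0 <= y by split; [exact: le_trans dxx | exact: le_trans dyy].
  have [rx0 ry0 _] := rP.
  have [H1 _] := Hn P.
  have ge := H1 tP mP x y x0 y0 (le_trans ndy dyy) (fun bP => nk (bk_bkn k.+1 bP)).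
  have orge : K%:R - 1 < off t0 (x - dx) (y - dy) by rewrite offB; lra.
  have xr : 0 < x - dx by apply: (off_gt0 t01 rx0 ry0); lra.
  have [_ [<-] [a' [d [p [Pd xd Pw]]]]] := bkn_attack x0 y0 nk.
  have [e [q [Pe rQ]]] := bk_step rP Pd (step_ge0 xr (rule_le1 Pd)).
  have [qx0 qy0 _] := rQ.
  have nz := Pw e q Pe.
  have Ex : x - dx + d = x + d - dx by rewrite addrAC.
  have Ey : y - dy + e = y + e - dy by rewrite addrAC.
  have dxd : dx <= x + d by rewrite -subr_ge0 -Ex.
  have dye : dy <= y + e by rewrite -subr_ge0 -Ey.
  have low : th (p, q) < th P0 \/ th (p, q) = th P0 /\ mu (p, q) < mu P0 -> False.
    move=> lt; have [k' k'K Hk'] := prec _ lt; apply: (Hk' _ _ qx0 qy0) rQ.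
    have le0 : th (p, q) <= t0 by case: lt => [/ltW|[->]].
    apply: lt_le_trans (off_anti le0 qx0 qy0); rewrite offD.
    have := off_step t01 (rule_le1 Pd) (rule_le1 Pe).
    have : (k'.+1)%:R <= K%:R :> R by rewrite ler_nat.
    by rewrite -natr1; lra.
  case: (ltgtP (th (p, q)) t0) => [lt|gt|eq].
  - by apply: low; left.
  - have [_ c0 blQ whQ] := thP (p, q); have [_ H2] := Hn (p, q).
    apply: (whQ _ _ qx0 qy0) rQ; rewrite Ex Ey offB.
    have zx0 : 0 <= x + d by exact: le_trans dxd.
    have zy0 : 0 <= y + e by exact: le_trans dye.
    have := wh_off_ge blQ zx0 zy0 (fun bQ => nz (bk_bkn k bQ)).
    have := H2 gt; rewrite [off (th _) dx dy](off_shift _ t0).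
    have : (th (p, q) - t0) * n%:R <= (th (p, q) - t0) * (dx + dy)%:~R.
      apply: ler_wpM2l; [by rewrite subr_ge0 ltW|rewrite pmulrn ler_int].
      by apply: (le_trans ndy); rewrite lerDr.
    by rewrite -[t0 - _]opprB mulNr; lra.
  - have [lt|ge'] := ltP (mu (p, q)) (mu P0); first by apply: low; right.
    by apply: (IH (p, q) (x + d) (y + e)) => //; rewrite -Ex -Ey.
have [k nk] := not_bk_bkn X0 Y0 nXY.
have := real_white k P0 X Y; rewrite /dx /dy !subKr; apply=> //.
- by rewrite lerBlDr lerDl.
- by rewrite lerBlDr lerDl.
Qed.

Lemma black_left P0 (K : nat) : 0 < th P0 -> (0 < K)%N ->
    (forall P, th P0 < th P \/ th P = th P0 /\ nu P0 < nu P ->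
      exists2 k : nat, (k < K)%N & forall x y, 0 <= x -> 0 <= y ->
        off (th P) x y < - (k%:R - 1) -> bk P x y) ->
  forall x y, 0 <= x -> 0 <= y -> off (th P0) x y < - (K%:R - 1) -> bk P0 x y.
Proof.
move=> th0 K0 prec a b a0 b0; set t0 := th P0 => ab; set o := off _ _ _ in ab.
have K1 : 1 <= K%:R :> R by rewrite ler1n.
have t01 : 0 <= t0 <= 1 by exact: th01.
pose eta := (- (K%:R - 1) - o) / 3.
have eta0 : 0 < eta by rewrite divr_gt0 // subr_gt0.
have etaE : 3 * eta = - (K%:R - 1) - o by rewrite mulrC divfK ?pnatr_eq0.
have [n Hn] : exists n : nat, forall P,
    (th P = t0 -> nu P <= nu P0 -> forall x y, n%:Z <= x ->
       bk P x y -> off t0 x y <= nu P0 + eta) /\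
    (th P < t0 -> o - (nu P0 - eta) + 2 * c P < (t0 - th P) * n%:R).
  apply: uniform_nat => [P n m nm [H1 H2]|P].
    split=> [e le x y mx|lt].
      by apply: H1 => //; apply: le_trans mx; rewrite lez_nat.
    by apply: (lt_le_trans (H2 lt)); rewrite ler_pM2l ?ler_nat // subr_gt0.
  case: (ltgtP t0 (th P)) => [lt|gt|e].
  - by exists 0%N; split=> // e; rewrite e ltxx in lt.
  - have [|n Hn] := @archi_lt _ (o - (nu P0 - eta) + 2 * c P) (t0 - th P).
      by rewrite subr_gt0.
    by exists n; split=> // e; rewrite e ltxx in gt.
  - have [|upper _] := nuP (P := P); first by rewrite -e.
    have [k Hk] := upper _ eta0; exists `|k|%N; split=> // _ le x y nx Pxy.
    rewrite e; apply: (le_trans _ (lerD le (lexx _))); apply: Hk => //.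
    by apply: le_trans nx; exact: lez_abs.
have [_ lower] := nuP th0.
have [X [Y [nX bXY oXY]]] := lower eta (n%:Z + a) eta0.
have [X0 Y0 _] := bXY.
have [Yb|bY] := leP Y b.
  by apply: (bk_mono bXY) => //; apply: le_trans nX; rewrite lerDr.
pose dx := X - a; pose dy := Y - b.
have dy0 : 0 <= dy by rewrite subr_ge0 ltW.
have ndx : n%:Z <= dx by rewrite lerBrDr.
have dx0 : 0 <= dx by apply: le_trans ndx.
have offV : nu P0 - eta - o <= off t0 dx dy.
  by rewrite /dx /dy offB; move: oXY; rewrite -/t0 -/o; lra.
pose S P u v := [/\ 0 <= u, 0 <= v &
  [/\ th P = t0, nu P <= nu P0 & bk P (u + dx) (v + dy)] \/ bk P u v].
apply: (@bk_coind _ _ N S); last first.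
  by split=> //; left; split=> //; rewrite [a + _]addrC [b + _]addrC !subrK.
move=> P u v [u0 v0 SP]; split=> // a' d p Pd ud.
case: SP => [[tP nP zP]|rP]; last first.
  have [e [q [Pe rQ]]] := bk_step rP Pd ud.
  by exists e, q; split=> //; have [? ? _] := rQ; split=> //; right.
have [H1 _] := Hn P.
have ndxu : n%:Z <= u + dx by apply: (le_trans ndx); rewrite lerDr.
have le := H1 tP nP _ _ ndxu zP.
have orle : off t0 u v < - (K%:R - 1) by move: le; rewrite offD; lra.
have v1 : 0 < v by apply: (off_lt0 t01 u0 v0); lra.
have zd : 0 <= u + dx + d by rewrite addrAC addr_ge0.
have [e [q [Pe zQ]]] := bk_step zP Pd zd.
have ve := step_ge0 v1 (rule_le1 Pe).
exists e, q; split=> //; split=> //.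
have high : th P0 < th (p, q) \/ th (p, q) = th P0 /\ nu P0 < nu (p, q) ->
    bk (p, q) (u + d) (v + e).
  move=> gt; have [k' k'K Hk'] := prec _ gt; apply: Hk' => //.
  have le0 : t0 <= th (p, q) by case: gt => [/ltW|[->]].
  apply: le_lt_trans (off_anti le0 ud ve) _; rewrite offD.
  have := off_step t01 (rule_le1 Pd) (rule_le1 Pe).
  have : (k'.+1)%:R <= K%:R :> R by rewrite ler_nat.
  by rewrite -natr1; lra.
case: (ltgtP (th (p, q)) t0) => [lt|gt|eq].
- right; have [_ c0 blQ whQ] := thP (p, q); have [_ H2] := Hn (p, q).
  apply: blQ => //; have := bk_off_le whQ zQ.
  rewrite [u + dx + d]addrAC [v + dy + e]addrAC [off _ (_ + _ + _) _]offD.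
  have := H2 lt; rewrite [off (th _) dx dy](off_shift _ t0).
  have : (t0 - th (p, q)) * n%:R <= (t0 - th (p, q)) * (dx + dy)%:~R.
    apply: ler_wpM2l; [by rewrite subr_ge0 ltW|rewrite pmulrn ler_int].
    by apply: (le_trans ndx); rewrite lerDl.
  by lra.
- by right; apply: high; left.
- have [lt|ge'] := ltP (nu P0) (nu (p, q)); first by right; apply: high; right.
  by left; split=> //; rewrite addrAC [v + e + dy]addrAC.
Qed.

End Neighbourhoods.

(** * Slopes *)

Lemma small_pos (R : realType) (T : finType) (r : T -> R) :
  exists2 eta, 0 < eta & forall t, 0 < r t -> eta < r t.
Proof.
have [|t|n Hn] := @uniform_nat T (fun t n => 0 < r t -> n.+1%:R^-1 < r t).
- move=> t n m nm lt /lt; apply: le_lt_trans.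
  by rewrite lef_pV2 ?posrE ?ltr0n // ler_nat.
- have [r0|] := ltP 0 (r t); last by exists 0%N.
  exists (Num.truncn (r t)^-1) => _; rewrite invf_plt ?posrE ?ltr0n //.
  exact: truncnS_gt.
- by exists n.+1%:R^-1 => [|t /Hn//]; rewrite invr_gt0 ltr0n.
Qed.

Lemma rank_exists (Q Act : finType) (N : ocn Q Act) (P : plane Q) (x y : int) k :
  ~ bkn N k P x y -> exists2 r, (r <= k)%N &
    ~ bkn N r P x y /\ forall j, ~ bkn N j P x y -> (r <= j)%N.
Proof.
move=> nk; have ex : exists k, `[< ~ bkn N k P x y >] by exists k; apply/asboolP.
case: (ex_minnP ex) => r /asboolP nr min.
by exists r; [apply/min/asboolP|split=> // j nj; apply/min/asboolP].
Qed.

Lemma far_ge (m n t : nat) (y d : int) : m%:Z + n%:Z + 1 <= y ->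
  - t%:Z <= d <= t%:Z -> (t <= n)%N -> m%:Z <= y + d.
Proof. by lia. Qed.

Lemma step_range (t : nat) (x d : int) : - t%:Z <= x <= t%:Z -> -1 <= d <= 1 ->
  - t.+1%:Z <= x + d <= t.+1%:Z.
Proof. by lia. Qed.

Lemma step_diff (j : nat) (x y z : int) : - j%:Z <= y - x <= j%:Z ->
  -1 <= z - y <= 1 -> - j.+1%:Z <= z - x <= j.+1%:Z.
Proof. by lia. Qed.

Lemma vec_index (j n : nat) (x : int) : - j%:Z <= x <= j%:Z -> (j <= n)%N ->
  (`|(x + n%:Z)%R| < (n + n).+1)%N /\ (`|(x + n%:Z)%R|%N)%:Z - n%:Z = x.
Proof. by lia. Qed.

Lemma abs_range (j n : nat) (x y : int) : - j%:Z <= x <= j%:Z ->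
    - j%:Z <= y <= j%:Z -> (j <= n)%N ->
    (0 < x) = (0 < y) /\ (x < 0) = (y < 0) -> (x != 0) || (y != 0) ->
  [/\ (1 <= `|x| <= n)%N, (1 <= `|y| <= n)%N &
      (`|x|%N%:Z = x /\ `|y|%N%:Z = y) \/ (`|x|%N%:Z = - x /\ `|y|%N%:Z = - y)].
Proof.
move=> xj yj jn [sx sy] xy0.
have [[x0 y0]|[x0 y0]] : (0 < x /\ 0 < y) \/ (x < 0 /\ y < 0).
- case: (ltgtP x 0) sx sy xy0 => [x0 _ y0 _|x0 y0 _ _|_ sx sy /= y0].
  + by right.
  + by left.
  + by case: (ltgtP y 0) y0 sx sy.
- by split; [lia|lia|left; lia].
- by split; [lia|lia|right; lia].
Qed.

Section Span.

Variables (R : realType) (Q Act : finType) (N : ocn Q Act).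

Implicit Types (P : plane Q) (x y d e : int).

Local Notation bk := (bk N).

Variables (th c mu nu : plane Q -> R).
Hypothesis thP : forall P, belted N (th P) (c P) P.
Hypothesis muP : forall P, th P < 1 -> white_liminf N (th P) P (mu P).
Hypothesis nuP : forall P, 0 < th P -> black_limsup N (th P) P (nu P).

Definition max_span (t0 : R) := [set P | (th P == t0) &&
  [forall P', (th P' == t0) ==> (nu P' - mu P' <= nu P - mu P)]].

(* Spoiler attacks at a white point on the left border of the belt while
   Duplicator defends a black point on its right border.  Both play the same
   moves; as the span is maximal, the play stays on the two borders, in planes
   of maximal span, and so the displacement between two visits of the same
   plane has offset 0. *)
Lemma max_span_slope P0 : 0 < th P0 < 1 -> exists x y : nat,
  [/\ (1 <= x <= #|max_span (th P0)|)%N, (1 <= y <= #|max_span (th P0)|)%N &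
      off (th P0) x%:Z y%:Z = 0].
Proof.
set t0 := th P0 => t0i; set n := #|_|.
have t01 : 0 <= t0 <= 1 by lra.
have [P1 tP1 maxP1] : exists2 P1, th P1 = t0 &
    forall P, th P = t0 -> nu P - mu P <= nu P1 - mu P1.
  have := @arg_maxP _ R _ P0 (fun P => th P == t0) (fun P => nu P - mu P) (eqxx _).
  by case=> P1 /eqP tP1 max; exists P1 => // P /eqP/max.
pose s1 := nu P1 - mu P1.
have Ms P : (P \in max_span t0) = (th P == t0) && (s1 <= nu P - mu P).
  rewrite inE; case: eqP => //= tP; apply/forallP/idP => [/(_ P1)|le P'].
    by rewrite tP1 eqxx.
  by apply/implyP => /eqP/maxP1 le'; apply: le_trans le.
have [eta1 eta10 Heta1] := @small_pos R _ (fun P => s1 - (nu P - mu P)).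
pose vec (i : 'I_(n + n).+1) : int := (i : nat)%:Z - n%:Z.
have [eta2 eta20 Heta2] := @small_pos R _ (fun ij => `|off t0 (vec ij.1) (vec ij.2)|).
pose eta := Num.min eta1 eta2 / 4.
have eta0 : 0 < eta by rewrite divr_gt0 // lt_min eta10.
have eta1E : 4 * eta <= eta1 by rewrite mulrC divfK ?pnatr_eq0 // ge_min lexx.
have eta2E : 4 * eta <= eta2 by rewrite mulrC divfK ?pnatr_eq0 // ge_min lexx orbT.
have [m Hm] : exists m : nat, forall P,
    [/\ th P = t0 -> forall x y, 0 <= x -> 0 <= y -> m%:Z <= y -> ~ bk P x y ->
          mu P - eta <= off t0 x y,
        th P = t0 -> forall x y, m%:Z <= x -> bk P x y -> off t0 x y <= nu P + eta,
        th P < t0 -> c P - (nu P1 - eta - n%:R) < (t0 - th P) * m%:R &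
        t0 < th P -> c P + (mu P1 + eta + n%:R) < (th P - t0) * m%:R].
  apply: uniform_nat => [P i j ij [H1 H2 H3 H4]|P].
    split=> [e x y x0 y0 my|e x y mx|lt|lt].
    - by apply: H1 => //; apply: le_trans my; rewrite lez_nat.
    - by apply: H2 => //; apply: le_trans mx; rewrite lez_nat.
    - by apply: (lt_le_trans (H3 lt)); rewrite ler_pM2l ?ler_nat // subr_gt0.
    - by apply: (lt_le_trans (H4 lt)); rewrite ler_pM2l ?ler_nat // subr_gt0.
  case: (ltgtP t0 (th P)) => [lt|gt|e].
  - have [|i Hi] := @archi_lt _ (c P + (mu P1 + eta + n%:R)) (th P - t0).
      by rewrite subr_gt0.
    by exists i; split=> // e; rewrite e ltxx in lt.
  - have [|i Hi] := @archi_lt _ (c P - (nu P1 - eta - n%:R)) (t0 - th P).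
      by rewrite subr_gt0.
    by exists i; split=> // e; rewrite e ltxx in gt.
  - have [|lower _] := muP (P := P); first by rewrite -e; case/andP: t0i.
    have [|upper _] := nuP (P := P); first by rewrite -e; case/andP: t0i.
    have [i Hi] := lower _ eta0; have [j Hj] := upper _ eta0.
    exists (`|i| + `|j|)%N; split=> // _ x y.
      move=> x0 y0 my nP; rewrite e; apply: Hi => //; apply: le_trans my.
      by rewrite PoszD; apply: (le_trans (lez_abs i)); rewrite lerDl.
    move=> mx Pxy; rewrite e; apply: Hj => //; apply: le_trans mx.
    by rewrite PoszD; apply: (le_trans (lez_abs j)); rewrite lerDr.
have lt1 : th P1 < 1 by rewrite tP1; case/andP: t0i.
have gt0 : 0 < th P1 by rewrite tP1; case/andP: t0i.
have [_ /(_ eta (m%:Z + n%:Z + 1) eta0) [X [Y [X0 Y0 mY nXY oXY]]]] := muP lt1.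
have [_ /(_ eta (m%:Z + n%:Z + 1) eta0) [X' [Y' [mX' bXY oXY']]]] := nuP gt0.
rewrite tP1 in oXY oXY'.
pose Inv t (s : plane Q * (int * int) * nat) :=
  [/\ 0 <= X + s.1.2.1, - t%:Z <= s.1.2.1 <= t%:Z, - t%:Z <= s.1.2.2 <= t%:Z,
      bk s.1.1 (X' + s.1.2.1) (Y' + s.1.2.2) &
      ~ bkn N s.2 s.1.1 (X + s.1.2.1) (Y + s.1.2.2) /\
      forall j, ~ bkn N j s.1.1 (X + s.1.2.1) (Y + s.1.2.2) -> (s.2 <= j)%N].
have border t s : (t <= n)%N -> Inv t s -> s.1.1 \in max_span t0 /\
    mu s.1.1 - eta <= off t0 (X + s.1.2.1) (Y + s.1.2.2) <= mu s.1.1 + 3 * eta.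
  case: s => [[P [x y]] k] tn [/= x0 xt yt bP [nP _]].
  have [H1 H2 H3 H4] := Hm P.
  have my := far_ge mY yt tn; have mx := far_ge mX' xt tn.
  have y0 : 0 <= Y + y by apply: le_trans my.
  have nP' : ~ bk P (X + x) (Y + y) by move/(@bk_bkn _ _ _ k).
  have tn' : t%:R <= n%:R :> R by rewrite ler_nat.
  have := off_bound t01 xt yt; have [_ _ blP whP] := thP P.
  rewrite !offD in H1 H2 *.
  case: (ltgtP (th P) t0) => [lt|gt|tP].
  - have := H3 lt; have := bk_off_le whP bP; rewrite (off_shift _ t0) offD.
    have [_ yy0 _] := bP.
    have : (t0 - th P) * m%:R <= (t0 - th P) * (X' + x + (Y' + y))%:~R.
      apply: ler_wpM2l; [by rewrite subr_ge0 ltW|rewrite pmulrn ler_int].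
      by apply: (le_trans mx); rewrite lerDl.
    by lra.
  - have := H4 gt; have := wh_off_ge blP x0 y0 nP'; rewrite (off_shift _ t0) offD.
    have : (th P - t0) * m%:R <= (th P - t0) * (X + x + (Y + y))%:~R.
      apply: ler_wpM2l; [by rewrite subr_ge0 ltW|rewrite pmulrn ler_int].
      by apply: (le_trans my); rewrite lerDr.
    by rewrite -[t0 - _]opprB mulNr; lra.
  - have := H1 tP _ _ x0 y0 my nP'; have := H2 tP _ _ mx bP.
    rewrite !offD => le1 le2 ob.
    have s1le : s1 <= nu P - mu P.
      rewrite leNgt; apply/negP => lt; have := Heta1 P; rewrite subr_gt0.
      by move/(_ lt); rewrite /s1; lra.
    split; last by have := maxP1 P tP; lra.
    by rewrite Ms tP eqxx.
pose st := (plane Q * (int * int) * nat)%type.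
have /choice[next nextP] (ts : nat * st) : exists s' : st, (ts.1 < n)%N ->
    Inv ts.1 ts.2 -> [/\ Inv ts.1.+1 s', (s'.2 < ts.2.2)%N,
      -1 <= s'.1.2.1 - ts.2.1.2.1 <= 1 & -1 <= s'.1.2.2 - ts.2.1.2.2 <= 1].
  case: ts => [t [[P [x y]] k]] /=.
  have [[tn iv]|no] := EM ((t < n)%N /\ Inv t ((P, (x, y)), k)); last first.
    by exists ((P, (x, y)), k) => tn iv; case: no.
  have [/= x0 xt yt bP [nP minP]] := iv.
  have y0 : 0 <= Y + y by apply: le_trans (far_ge mY yt (ltnW tn)).
  have [k' kk' [a [d [p [Pd xd Pw]]]]] := bkn_attack x0 y0 nP.
  have xt' := step_range xt (rule_le1 Pd).
  have xd' : 0 <= X' + x + d.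
    by rewrite -addrA; apply: le_trans (far_ge mX' xt' tn).
  have [e [q [Pe bQ]]] := bk_step bP Pd xd'.
  have [r rk [nr minr]] := rank_exists (Pw e q Pe).
  exists ((p, q), (x + d, y + e), r) => _ _; split=> /=.
  - split=> //=; rewrite ?addrA //; exact: step_range (rule_le1 Pe).
  - by rewrite kk' ltnS.
  - by rewrite addrAC subrr add0r; apply: rule_le1 Pd.
  - by rewrite addrAC subrr add0r; apply: rule_le1 Pe.
have [k0 nk0] := not_bk_bkn X0 Y0 nXY.
have [r0 _ [nr0 minr0]] := rank_exists nk0.
pose s := fix s t : st := if t is t'.+1 then next (t', s t') else ((P1, (0, 0)), r0).
have InvS t : (t <= n)%N -> Inv t (s t).
  elim: t => [_|t IH tn]; last by have [] := nextP (t, s t) tn (IH (ltnW tn)).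
  by split; rewrite /= ?addr0 ?oppr0 ?lexx.
have gap i j : (i + j <= n)%N -> [/\ ((s (i + j)%N).2 + j <= (s i).2)%N,
    - j%:Z <= (s (i + j)%N).1.2.1 - (s i).1.2.1 <= j%:Z &
    - j%:Z <= (s (i + j)%N).1.2.2 - (s i).1.2.2 <= j%:Z].
  elim: j => [|j IH] ijn; first by rewrite !addn0 !subrr oppr0 lexx leqnn.
  rewrite !addnS in ijn *; have [IH1 IH2 IH3] := IH (ltnW ijn).
  have [_ lt dx dy] := nextP (_, s (i + j)%N) ijn (InvS _ (ltnW ijn)).
  split; [|exact: step_diff IH2 dx|exact: step_diff IH3 dy].
  by rewrite -addSn (leq_trans _ IH1) // leq_add2r.
have [i [j [j0 ijn sameP]]] : exists i j : nat, [/\ (0 < j)%N, (i + j <= n)%N &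
    (s i).1.1 = (s (i + j)%N).1.1].
  apply: contrapT => noij.
  pose f (t : 'I_n.+1) := (s t).1.1.
  have inj : injective f.
    suff wl (t u : 'I_n.+1) : (t <= u)%N -> f t = f u -> t = u.
      by move=> t u; have [/wl//|/ltnW/wl H /esym/H] := leqP t u.
    rewrite leq_eqVlt => /orP[/eqP /val_inj//|tu ftu]; case: noij.
    exists t, (u - t)%N; rewrite subn_gt0 subnKC ?(ltnW tu) //; split=> //.
    by rewrite -ltnS.
  have : (n.+1 <= n)%N.
    rewrite -[X in (X <= _)%N]card_ord -(card_codom inj) /n; apply: subset_leq_card.
    apply/fintype.subsetP => _ /codomP[t ->].
    by have [] := border t (s t) (ltnSE (ltn_ord t)) (InvS t (ltnSE (ltn_ord t))).
  by rewrite ltnn.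
set x := (s (i + j)%N).1.2.1 - (s i).1.2.1; set y := (s (i + j)%N).1.2.2 - (s i).1.2.2.
have iijn : (i <= n)%N by apply: leq_trans (leq_addr _ _) ijn.
have [rk xj yj] := gap i j ijn; rewrite -/x in xj; rewrite -/y in yj.
have jn : (j <= n)%N by apply: leq_trans (leq_addl _ _) ijn.
have oxy : off t0 x y = 0.
  have [_ bi] := border i _ iijn (InvS i iijn).
  have [_] := border (i + j)%N _ ijn (InvS _ ijn); rewrite -sameP => bij.
  apply/eqP; apply: contraT => xy0.
  have [xv vx] := vec_index xj jn; have [yv vy] := vec_index yj jn.
  have := Heta2 (Ordinal xv, Ordinal yv); rewrite /vec /= vx vy normr_gt0.
  move=> /(_ xy0); rewrite ltNge => /negP[]; apply: le_trans eta2E.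
  rewrite !offD in bi bij; rewrite /x /y offB ler_norml.
  by move: bi bij; move: (mu _) (off t0 _ _) (off t0 _ _) => *; lra.
have xy0 : (x != 0) || (y != 0).
  rewrite -negb_and; apply/negP => /andP[]; rewrite !subr_eq0 => /eqP ex /eqP ey.
  have [_ _ _ _ [nk _]] := InvS _ ijn; have [_ _ _ _ [_ mink]] := InvS i iijn.
  move: nk; rewrite ex ey -sameP => /mink le.
  by have := leq_trans rk le; rewrite -[leqRHS]addn0 leq_add2l leqNgt j0.
move: oxy; rewrite /off => /eqP; rewrite subr_eq0 => /eqP oxy.
have [t0p t1p] : 0 < t0 /\ 0 < 1 - t0 by rewrite subr_gt0; split; case/andP: t0i.
have sx : ((0 < x) = (0 < y)) /\ ((x < 0) = (y < 0)).
  rewrite -!(ltr_int R) -(pmulr_rgt0 _ t1p) oxy pmulr_rgt0 //; split=> //.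
  by rewrite -(pmulr_rlt0 _ t1p) oxy pmulr_rlt0.
have [rx ry abs] := abs_range xj yj jn sx xy0.
exists `|x|%N, `|y|%N; split=> //; rewrite /off.
case: abs => -[-> ->]; first by rewrite oxy subrr.
by rewrite !rmorphN /= !mulrN oxy opprK addNr.
Qed.

End Span.
Lemma set_max_eq (d : Order.disp_t) (T : porderType d) (x0 : T) (A : set T) x :
  A x -> ubound A x -> set_max x0 A = x.
Proof.
move=> Ax ux; apply: xget_unique => // y [Ay uy].
by apply/le_anti; rewrite ux // uy.
Qed.

Lemma set_min_eq (d : Order.disp_t) (T : porderType d) (x0 : T) (A : set T) x :
  A x -> lbound A x -> set_min x0 A = x.
Proof.
move=> Ax lx; apply: xget_unique => // y [Ay ly].
by apply/le_anti; rewrite lx // ly.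
Qed.

Lemma infinite_natP (A : set nat) :
  (forall k, exists2 n, (k <= n)%N & A n) <-> infinite_set A.
Proof.
split=> [unb /finite_seqP[s As]|infA k].
  have [n lt An] := unb (\max_(i <- s) i).+1.
  have ns : n \in s by move: An; rewrite As.
  by move: lt; rewrite ltnNge => /negP[]; apply: leq_bigmax_seq.
apply: contrapT => noN; apply: infA; apply: (@sub_finite_set _ _ [set` iota 0 k]).
  move=> n An /=; rewrite mem_iota /= add0n ltnNge; apply/negP => kn.
  by apply: noN; exists n.
by apply/finite_seqP; exists (iota 0 k).
Qed.

Section Frontier.

Variables (R : realType) (Q Act : finType) (N : ocn Q Act).

Implicit Types (P : plane Q) (x y d e f : int) (th c : R).

Local Notation bk := (bk N).
Local Notation belted := (belted N).

Lemma bk_nat P (m n : nat) : bk P m%:Z n%:Z <-> black N P m n.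
Proof. by split=> [[]|]. Qed.

Lemma frontierP P (n : nat) :
  (frontier N P n = +oo%E /\ forall x, 0 <= x -> bk P x n%:Z) \/
  exists f, [/\ frontier N P n = f%:E, -1 <= f &
    forall x, 0 <= x -> (bk P x n%:Z <-> x <= f)].
Proof.
have down (m m' : nat) : (m <= m')%N -> black N P m' n -> black N P m n.
  by move=> mm' /bk_nat b; apply/bk_nat; apply: (bk_mono b).
rewrite /frontier; case: asboolP => [all|nall]; [left|right].
  by split=> // x x0; rewrite -(gez0_abs x0); apply/bk_nat.
case: asboolP => [w0|b0].
  exists (-1); split=> // x x0; split=> [|x1]; last by lia.
  by rewrite -(gez0_abs x0) => /bk_nat/(down _ _ (leq0n _)).
have {}b0 : black N P 0 n by apply: contrapT.
have [M wM] : exists M, ~ black N P M n by apply/existsNP.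
have ex : exists m, `[< black N P m n >] by exists 0%N; apply/asboolP.
have bound m : `[< black N P m n >] -> (m <= M)%N.
  by move/asboolP => bm; rewrite leqNgt; apply/negP => /ltnW/down/(_ bm).
case: (ex_maxnP ex bound) => g /asboolP bg maxg.
exists g%:Z; split=> [|//|x x0].
  congr (_%:E%E); congr Posz; apply: set_max_eq => // m bm.
  by apply: maxg; apply/asboolP.
rewrite -(gez0_abs x0) lez_nat bk_nat; split=> [bx|le]; last exact: down bg.
by apply: maxg; apply/asboolP.
Qed.

Definition fr P (n : nat) : int := fine (frontier N P n).

Lemma frP th c P (n : nat) : belted th c P -> th < 1 ->
  [/\ frontier N P n = (fr P n)%:E, -1 <= fr P n &
    forall x, 0 <= x -> (bk P x n%:Z <-> x <= fr P n)].
Proof.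
move=> [_ c0 _ whP] th1; rewrite /fr.
have [[_ all]|[f [-> f1 fP]]] := frontierP P n; last by split.
have [|k] := @archi_lt _ (c + th * n%:R) (1 - th); first by rewrite subr_gt0.
by rewrite -ltrBrDr => /(whP k%:Z n%:Z) []//; apply: all.
Qed.

Lemma fr_white P (n : nat) : -1 <= fr P n ->
    (forall x, 0 <= x -> (bk P x n%:Z <-> x <= fr P n)) ->
  0 <= fr P n + 1 /\ ~ bk P (fr P n + 1) n%:Z.
Proof.
move=> f1 fP; have f0 : 0 <= fr P n + 1 by rewrite -lerBlDr sub0r.
by split=> // /(fP _ f0); rewrite gerDl.
Qed.

Lemma frontier_infty P (n : nat) :
  frontier N P n = +oo%E <-> forall x, 0 <= x -> bk P x n%:Z.
Proof.
split=> [|all]; have [[->//]|[f [-> f1 fP]] //] := frontierP P n.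
have f0 : 0 <= f + 1 by rewrite -lerBlDr sub0r.
by have /(fP _ f0) := all _ f0; rewrite gerDl.
Qed.

Lemma HF_th th c P : belted th c P -> (P \in HF N) = (th == 1).
Proof.
move=> bP; have [/andP[th0 th1] c0 blP whP] := bP.
rewrite inE; apply/asboolP/eqP => [[n fn]|e].
  apply/eqP; rewrite eq_le th1 leNgt; apply/negP => lt.
  by have [] := frP n bP lt; rewrite fn.
exists (Num.truncn c).+1; apply/frontier_infty => x x0; apply: blP => //.
by rewrite e /off subrr mul0r mul1r sub0r ltrN2 -pmulrn truncnS_gt.
Qed.

Lemma VF_th th c P : belted th c P -> (P \in VF N) = (th == 0).
Proof.
move=> bP; have [/andP[th0 th1] c0 blP whP] := bP.
rewrite inE (HF_th bP); have [->|th1'] := eqVneq th 1; first by rewrite oner_eq0.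
have lt : th < 1 by rewrite lt_neqAle th1'.
apply/asboolP/eqP => [[m fm]|e].
  apply/eqP; rewrite eq_le th0 andbT leNgt; apply/negP => gt.
  have [k Hk] := @archi_lt _ (c + (1 - th) * (`|m| + 1)%N%:R) _ gt.
  have [fE _ fP] := frP k bP lt.
  have : bk P (`|m| + 1)%N k by apply: blP => //; rewrite /off -!pmulrn; lra.
  move=> /(fP _ (le0z_nat _)) le; move: (fm k); rewrite fE lee_fin => /(le_trans le).
  by rewrite PoszD lezD1 ltNge lez_abs.
exists (Num.floor c) => n; have [-> f1 fP] := frP n bP lt.
rewrite lee_fin; have [f0|fneg] := leP 0 (fr P n); last first.
  by apply: (le_trans (ltW fneg)); rewrite floor_ge0.
rewrite floor_ge_int //; have /(fP _ f0)/(bk_off_le whP) := lexx (fr P n).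
by rewrite e /off subr0 mul1r mul0r subr0.
Qed.

Lemma SF_th th c P : belted th c P -> (P \in SF N) = (0 < th < 1).
Proof.
move=> bP; have [/andP[th0 th1] _ _ _] := bP.
rewrite finset.in_setC finset.in_setU (HF_th bP) (VF_th bP) negb_or.
by rewrite !lt_neqAle th0 th1 !andbT andbC eq_sym.
Qed.

End Frontier.

Section Distance.

Variable R : realType.

Implicit Types (a b x y z t : R).

Lemma inf_min (A : set R) (m : R) : A m -> lbound A m -> inf A = m.
Proof.
move=> Am lm; apply/le_anti/andP; split; last by apply: lb_le_inf => //; exists m.
by apply: ge_inf => //; exists m.
Qed.

Lemma dist_graph a x y : 0 < a ->
  dist (x, y) (Graph a 0) = (a * x - y) / Num.sqrt (1 + a ^+ 2).
Proof.
move=> a0; pose s := 1 + a ^+ 2.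
have s0 : 0 < s by rewrite ltr_pwDl // sqr_ge0.
rewrite /dist (@inf_min _ (Num.sqrt ((a * x - y) ^+ 2 / s))); first last.
- move=> _ [[u v] /= + <-]; rewrite addr0 => ->; rewrite /eucl ler_sqrt; last first.
    by rewrite addr_ge0 ?sqr_ge0.
  rewrite ler_pdivrMr // -subr_ge0 /=.
  have -> : ((x - u) ^+ 2 + (y - a * u) ^+ 2) * s - (a * x - y) ^+ 2 =
            ((x - u) + a * (y - a * u)) ^+ 2 by rewrite /s; ring.
  exact: sqr_ge0.
- pose r := (a * x - y) / s.
  exists (x - a * r, a * (x - a * r)); first by rewrite /= addr0.
  rewrite /eucl /=; congr Num.sqrt; rewrite /r /s; field.
  exact: lt0r_neq0.
rewrite sqrtrM ?sqr_ge0 // sqrtr_sqr sqrtrV ?ltW // /= subr0.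
rewrite ltr_pdivlMr // mulrC -subr_lt0; case: ltrP => [lt|ge].
  by rewrite ltr0_norm // mulNr opprK.
by rewrite ger0_norm.
Qed.

Lemma dist_vertical x y : dist (x, y) (Vertical 0) = x.
Proof.
rewrite /dist (@inf_min _ `|x|) /=; first last.
- move=> _ [[u v] /= -> <-]; rewrite /eucl /= subr0 -sqrtr_sqr ler_sqrt.
    by rewrite lerDl sqr_ge0.
  by rewrite addr_ge0 ?sqr_ge0.
- by exists (0, y) => //; rewrite /eucl /= subr0 subrr expr0n addr0 sqrtr_sqr.
by case: ltrP => [/ltr0_norm->|/ger0_norm]; rewrite ?opprK.
Qed.

(* Ratio between Euclidean distances from the ray and offsets. *)
Definition scale t : R :=
  if t == 0 then 1 else (t * Num.sqrt (1 + ((1 - t) / t) ^+ 2))^-1.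

Lemma scale_gt0 t : 0 <= t -> 0 < scale t.
Proof.
move=> t0; rewrite /scale; case: eqVneq => // tn0.
have t1 : 0 < t by rewrite lt_neqAle eq_sym tn0.
by rewrite invr_gt0 mulr_gt0 // sqrtr_gt0 ltr_pwDl // sqr_ge0.
Qed.

Lemma dist_scale t (x y : int) : 0 < t < 1 ->
  dist (x%:~R, y%:~R) (Graph ((1 - t) / t) 0) = scale t * off t x y.
Proof.
move=> /andP[t0 t1]; rewrite dist_graph ?divr_gt0 ?subr_gt0 // /scale gt_eqF //.
have s0 : Num.sqrt (1 + ((1 - t) / t) ^+ 2) != 0.
  by rewrite gt_eqF // sqrtr_gt0 ltr_pwDl // sqr_ge0.
move: (Num.sqrt _) s0 => s s0; rewrite /off; field.
by rewrite s0 gt_eqF.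
Qed.

End Distance.

Lemma discrete_limit (R : realType) (S : int -> R -> Prop) (q : nat) (mu : R) :
    (0 < q)%N -> (forall k k' v, k <= k' -> S k' v -> S k v) ->
    (forall k v, S k v -> exists z : int, q%:R * v = z%:~R) ->
    (forall eta, 0 < eta -> exists k, forall v, S k v -> mu - eta <= v) ->
    (forall eta k, 0 < eta -> exists2 v, S k v & v <= mu + eta) ->
  (exists k, forall v, S k v -> mu <= v) /\ forall k, S k mu.
Proof.
move=> q0 mono disc lower upper; have q0R : 0 < q%:R :> R by rewrite ltr0n.
pose F := Num.floor (q%:R * mu).
have := floor_itv (q%:R * mu); rewrite -/F rmorphD /= => /andP[F1 F2].
have muF : q%:R * mu = F%:~R.
  apply/eqP; rewrite eq_le F1 andbT leNgt; apply/negP => lt.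
  pose eta := Num.min (q%:R * mu - F%:~R) (F%:~R + 1 - q%:R * mu) / (2 * q%:R).
  have m0 : 0 < Num.min (q%:R * mu - F%:~R) (F%:~R + 1 - q%:R * mu).
    by rewrite lt_min !subr_gt0 lt.
  have eta0 : 0 < eta by rewrite divr_gt0 // mulr_gt0.
  have etaE : 2 * (q%:R * eta) = Num.min (q%:R * mu - F%:~R) (F%:~R + 1 - q%:R * mu).
    by rewrite mulrA mulrC divfK // gt_eqF // mulr_gt0.
  have [k Hk] := lower _ eta0; have [v Sv vle] := upper eta k eta0.
  have [z zE] := disc _ _ Sv; have vge := Hk v Sv.
  have : F%:~R < z%:~R :> R.
    have := ler_wpM2l (ltW q0R) vge; rewrite -zE mulrBr.
    have : 2 * (q%:R * eta) <= q%:R * mu - F%:~R by rewrite etaE ge_min lexx.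
    have : 0 < q%:R * eta by rewrite mulr_gt0.
    by lra.
  have : z%:~R < (F + 1)%:~R :> R.
    have := ler_wpM2l (ltW q0R) vle; rewrite -zE mulrDr rmorphD /=.
    have : 2 * (q%:R * eta) <= F%:~R + 1 - q%:R * mu by rewrite etaE ge_min lexx orbT.
    have : 0 < q%:R * eta by rewrite mulr_gt0.
    by lra.
  by rewrite !ltr_int ltzD1 => /le_lt_trans/[apply]; rewrite ltxx.
pose eta : R := (2 * q%:R)^-1.
have eta0 : 0 < eta by rewrite invr_gt0 mulr_gt0.
have etaE : q%:R * eta = 2^-1 by rewrite /eta invfM mulrCA divff ?mulr1 // gt_eqF.
have [k Hk] := lower _ eta0.
have lb v : S k v -> mu <= v.
  move=> Sv; have [z zE] := disc _ _ Sv; have := Hk v Sv.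
  rewrite -(ler_pM2l q0R) mulrBr etaE zE muF => le.
  rewrite -(ler_pM2l q0R) zE muF ler_int -ltzD1 -(ltr_int R) rmorphD /=.
  by lra.
split=> [|k']; first by exists k.
have [v Sv vle] := upper eta (Num.max k k') eta0.
suff -> : mu = v by apply: mono Sv; rewrite le_max lexx orbT.
have kmax : k <= Num.max k k' by rewrite le_max lexx.
apply/le_anti; rewrite (lb v (mono _ _ _ kmax Sv)) /=.
have [z zE] := disc _ _ Sv.
move: vle; rewrite -(ler_pM2l q0R) mulrDr etaE zE muF => le.
rewrite -(ler_pM2l q0R) zE muF ler_int -ltzD1 -(ltr_int R) rmorphD /=.
by lra.
Qed.

Section Slope.

Variables (R : realType) (Q Act : finType) (N : ocn Q Act).

Implicit Types (P : plane Q) (x y d e f : int).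

Local Notation bk := (bk N).
Local Notation fr := (fr N).

Variables (th c mu nu : plane Q -> R).
Hypothesis thP : forall P, belted N (th P) (c P) P.
Hypothesis muP : forall P, th P < 1 -> white_liminf N (th P) P (mu P).
Hypothesis nuP : forall P, 0 < th P -> black_limsup N (th P) P (nu P).

Let th_ge0 P : 0 <= th P. Proof. by have [/andP[]] := thP P. Qed.

Let fr_finite P (n : nat) : th P < 1 -> [/\ frontier N P n = (fr P n)%:E,
  -1 <= fr P n & forall x, 0 <= x -> (bk P x n%:Z <-> x <= fr P n)].
Proof. exact: frP. Qed.

Lemma off_succ (t : R) x y : off t (x + 1) y = off t x y + (1 - t).
Proof. by rewrite /off rmorphD /=; ring. Qed.

Lemma fr_off_le P (n : nat) : th P < 1 -> off (th P) (fr P n) n%:Z <= c P.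
Proof.
move=> t1; have [_ f1 fP] := fr_finite n t1; have [_ c0 _ whP] := thP P.
have [f0|fneg] := leP 0 (fr P n).
  by have /(fP _ f0)/(bk_off_le whP) := lexx (fr P n).
apply: le_trans c0; rewrite /off subr_le0; apply: (@le_trans _ _ 0).
  by rewrite mulr_ge0_le0 ?subr_ge0 ?(ltW t1) // lerz0 ltW.
by rewrite mulr_ge0.
Qed.

Lemma fr_off_ge P (n : nat) : th P < 1 -> - (c P + 1) <= off (th P) (fr P n) n%:Z.
Proof.
move=> t1; have [_ f1 fP] := fr_finite n t1; have [_ c0 blP _] := thP P.
have [f0 nP] := fr_white f1 fP.
have := wh_off_ge blP f0 (le0z_nat n) nP; rewrite off_succ.
by have := th_ge0 P; lra.
Qed.

Lemma fr_unbounded P (k : nat) : 0 < th P < 1 ->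
  exists m : nat, forall n : nat, (m <= n)%N -> k%:Z <= fr P n.
Proof.
move=> /andP[t0 t1]; have [_ _ blP _] := thP P.
have [m Hm] := archi_lt (c P + (1 - th P) * k%:R) t0.
exists m => n mn; have [_ _ fP] := fr_finite n t1; apply/(fP _ (le0z_nat k)).
apply: blP => //; rewrite /off -!pmulrn.
have : th P * m%:R <= th P * n%:R by rewrite ler_pM2l // ler_nat.
by lra.
Qed.

Lemma slope_SF P (a : rat) : 0 < th P < 1 -> ratr a = (1 - th P) / th P ->
  slope R N P = a%:E.
Proof.
move=> t01 aE; have /andP[t0 t1] := t01.
rewrite /slope (HF_th (thP P)) (VF_th (thP P)) lt_eqF // gt_eqF //.
congr _%:E; apply: xget_unique.
  split; first by rewrite -(ltr0q R) aE divr_gt0 // subr_gt0.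
  exists (scale (th P) * (c P + 1)) => n.
  rewrite /frontier_dist /slope_line aE [n%:R]pmulrn dist_scale // normrM.
  have sc0 := scale_gt0 (ltW t0); rewrite (gtr0_norm sc0) ler_wpM2l ?(ltW sc0) //.
  rewrite ler_norml fr_off_ge //= (le_trans (fr_off_le _ t1)) //.
  by rewrite lerDl.
move=> b [b0 [B HB]]; apply/(fmorph_inj (ratr : {rmorphism rat -> R}))/eqP.
rewrite /= aE; set al := _ / _; set be := ratr b; apply: contraT => neq.
have be0 : 0 < be by rewrite ltr0q.
pose s := Num.sqrt (1 + be ^+ 2).
have s0 : 0 < s by rewrite sqrtr_gt0 ltr_pwDl // sqr_ge0.
have d0 : 0 < `|be - al| by rewrite normr_gt0 subr_eq0.
have [k Hk] := archi_lt (B * s + (c P + 1) / th P) d0.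
have [m Hm] := fr_unbounded k t01; have := Hm m (leqnn m).
rewrite -(ler_int R) -pmulrn => kf.
have f0 : 0 <= (fr P m)%:~R :> R by apply: le_trans kf.
have : `|be - al| * (fr P m)%:~R <= B * s + (c P + 1) / th P.
  have -> : `|be - al| * (fr P m)%:~R = `|(be - al) * (fr P m)%:~R|.
    by rewrite normrM (ger0_norm f0).
  have -> : (be - al) * (fr P m)%:~R = (be * (fr P m)%:~R - m%:R) -
      off (th P) (fr P m) m / th P.
    by rewrite /off /al -pmulrn; field; rewrite gt_eqF.
  apply: (le_trans (ler_normB _ _)); apply: lerD.
    have := HB m; rewrite /frontier_dist /slope_line dist_graph // normrM normfV.
    by rewrite -/s (gtr0_norm s0) ler_pdivrMr.
  rewrite normrM normfV [`|th P|]gtr0_norm // ler_pM2r ?invr_gt0 //.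
  rewrite ler_norml fr_off_ge //= (le_trans (fr_off_le _ t1)) //.
  by rewrite lerDl.
have : `|be - al| * k%:R <= `|be - al| * (fr P m)%:~R by rewrite ler_pM2l.
by move: Hk; lra.
Qed.

End Slope.

Section Orders.

Variables (R : realType) (Q Act : finType) (N : ocn Q Act).

Implicit Types (P : plane Q) (x y d e f : int).

Local Notation bk := (bk N).
Local Notation fr := (fr N).
Local Notation slope := (slope R N).

Variables (th c mu nu : plane Q -> R).
Hypothesis thP : forall P, belted N (th P) (c P) P.
Hypothesis muP : forall P, th P < 1 -> white_liminf N (th P) P (mu P).
Hypothesis nuP : forall P, 0 < th P -> black_limsup N (th P) P (nu P).

Let th_ge0 P : 0 <= th P. Proof. by have [/andP[]] := thP P. Qed.
Let th_le1 P : th P <= 1. Proof. by have [/andP[]] := thP P. Qed.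

Lemma slope_ratio P : 0 < th P < 1 -> exists x y : nat,
  [/\ (1 <= x <= #|max_span th mu nu (th P)|)%N,
      (1 <= y <= #|max_span th mu nu (th P)|)%N,
      (1 - th P) * x%:R = th P * y%:R,
      ratr (y%:R / x%:R) = (1 - th P) / th P :> R &
      slope P = (y%:R / x%:R)%:E].
Proof.
move=> t01; have /andP[t0 t1] := t01.
have [x [y [xM yM /eqP]]] := max_span_slope thP muP nuP t01.
rewrite /off subr_eq0 -!pmulrn => /eqP e.
have /andP[x0 _] := xM.
have ae : ratr (y%:R / x%:R) = (1 - th P) / th P :> R.
  rewrite fmorph_div /= !ratr_nat; apply/eqP.
  by rewrite eqr_div ?lt0r_neq0 ?ltr0n // e mulrC.
by exists x, y; split=> //; apply: slope_SF ae.
Qed.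

Lemma slope_cases P : [\/ th P = 1 /\ slope P = 0%:E, th P = 0 /\ slope P = +oo%E |
  0 < th P < 1 /\ exists2 a, slope P = a%:E & ratr a = (1 - th P) / th P :> R].
Proof.
have [e|n1] := eqVneq (th P) 1.
  by constructor 1; rewrite /Defs.slope (HF_th (thP P)) e eqxx.
have [e|n0] := eqVneq (th P) 0.
  constructor 2; rewrite /Defs.slope (HF_th (thP P)) (VF_th (thP P)) e eqxx.
  by rewrite eq_sym oner_eq0.
constructor 3; have t01 : 0 < th P < 1 by rewrite !lt_neqAle th_ge0 th_le1 eq_sym n0 n1.
by split=> //; have [x [y [_ _ _ a s]]] := slope_ratio t01; exists (y%:R / x%:R).
Qed.

Lemma slope_lt P P' : (slope P < slope P')%E = (th P' < th P).
Proof.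
have cot (t : R) : 0 < t -> (1 - t) / t = t^-1 - 1.
  by move=> t0; rewrite mulrBl mul1r divff // gt_eqF.
have [[-> ->]|[-> ->]|[/andP[t0 t1] [a -> ae]]] := slope_cases P;
have [[-> ->]|[-> ->]|[/andP[t0' t1'] [b -> be]]] := slope_cases P'.
- by rewrite !ltxx.
- by rewrite ltry ltr01.
- by rewrite lte_fin -(ltr0q R) be divr_gt0 ?subr_gt0.
- by rewrite ltNge leey ltNge ler01.
- by rewrite !ltxx.
- by rewrite ltNge leey ltNge (ltW t0').
- rewrite lte_fin ltNge ltW; last by rewrite -(ltr0q R) ae divr_gt0 ?subr_gt0.
  by rewrite ltNge (ltW t1).
- by rewrite ltry t0.
- by rewrite lte_fin -(ltr_rat R) ae be !cot // ltrD2r ltf_pV2.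
Qed.

Lemma slope_eq P P' : (slope P == slope P') = (th P == th P').
Proof. by rewrite !eq_le !leNgt !slope_lt andbC. Qed.

Lemma dist_belt P (n : nat) : th P < 1 ->
  frontier_dist N P (belt_line R N P) n = scale (th P) * off (th P) (fr P n) n.
Proof.
move=> t1; rewrite /belt_line /frontier_dist.
have [[e _]|[e ->]|[t01 [a -> ae]]] := slope_cases P.
- by rewrite e ltxx in t1.
- by rewrite /slope_line dist_vertical e /scale eqxx mul1r /off subr0 mul1r mul0r subr0.
- by rewrite /slope_line ae [n%:R]pmulrn dist_scale.
Qed.

Lemma off_discrete P : th P < 1 ->
  exists2 q : nat, (0 < q)%N & forall x y, exists z : int, q%:R * off (th P) x y = z%:~R.
Proof.
move=> t1; have [e|n0] := eqVneq (th P) 0.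
  by exists 1%N => // x y; exists x; rewrite mul1r e /off subr0 mul1r mul0r subr0.
have t01 : 0 < th P < 1 by rewrite t1 lt_neqAle eq_sym n0 th_ge0.
have [a [b [/andP[a0 _] _ e _ _]]] := slope_ratio t01.
exists (a + b)%N => [|x y]; first by rewrite addn_gt0 a0.
exists (b%:Z * x - a%:Z * y); rewrite rmorphB !rmorphM /= -!pmulrn natrD /off.
apply/eqP; rewrite -subr_eq0; set u := x%:~R; set v := y%:~R.
have -> : (a%:R + b%:R) * ((1 - th P) * u - th P * v) - (b%:R * u - a%:R * v) =
    (u + v) * ((1 - th P) * a%:R - th P * b%:R) by ring.
by rewrite e subrr mulr0.
Qed.

Lemma white_exact P : th P < 1 ->
  (exists k, forall x y, 0 <= x -> 0 <= y -> k <= y -> ~ bk P x y ->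
     mu P <= off (th P) x y) /\
  forall k, exists x y, [/\ 0 <= x, 0 <= y, k <= y, ~ bk P x y & off (th P) x y = mu P].
Proof.
move=> t1; have [q q0 disc] := off_discrete t1; have [lower upper] := muP t1.
pose S k (v : R) := exists x y, [/\ 0 <= x, 0 <= y, k <= y, ~ bk P x y & v = off (th P) x y].
have [||||[k Hk] SM] := @discrete_limit _ S q (mu P) q0.
- move=> k k' v kk' [x [y [x0 y0 k'y nP ->]]].
  by exists x, y; split=> //; apply: le_trans k'y.
- by move=> _ _ [x [y [_ _ _ _ ->]]].
- move=> eta /lower[k Hk]; exists k => _ [x [y [x0 y0 ky nP ->]]].
  exact: Hk.
- move=> eta k /(upper eta k)[x [y [x0 y0 ky nP le]]].
  by exists (off (th P) x y) => //; exists x, y.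
split=> [|k']; last by have [x [y [x0 y0 ky nP ->]]] := SM k'; exists x, y.
by exists k => x y x0 y0 ky nP; apply: Hk; exists x, y.
Qed.

Lemma black_exact P : 0 < th P < 1 ->
  (exists k, forall x y, k <= x -> bk P x y -> off (th P) x y <= nu P) /\
  forall k, exists x y, [/\ k <= x, bk P x y & off (th P) x y = nu P].
Proof.
move=> /andP[t0 t1]; have [q q0 disc] := off_discrete t1.
have [lower upper] := nuP t0.
pose S k (v : R) := exists x y, [/\ k <= x, bk P x y & v = - off (th P) x y].
have [||||[k Hk] SM] := @discrete_limit _ S q (- nu P) q0.
- move=> k k' v kk' [x [y [k'x bP ->]]].
  by exists x, y; split=> //; apply: le_trans k'x.
- move=> _ _ [x [y [_ _ ->]]]; have [z zE] := disc x y.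
  by exists (- z); rewrite mulrN zE rmorphN.
- move=> eta /lower[k Hk]; exists k => _ [x [y [kx bP ->]]].
  by rewrite -opprD lerN2; apply: Hk.
- move=> eta k /(upper eta k)[x [y [kx bP le]]].
  exists (- off (th P) x y); first by exists x, y.
  by move: le; lra.
split=> [|k'].
  by exists k => x y kx bP; rewrite -lerN2; apply: Hk; exists x, y.
by have [x [y [kx bP /oppr_inj ->]]] := SM k'; exists x, y.
Qed.

Lemma nat_ge (k : int) (n : nat) : (`|k| <= n)%N -> k <= n%:Z.
Proof. by rewrite -lez_nat; apply: le_trans; apply: lez_abs. Qed.

Lemma off_homo_x (t : R) x x' y : t <= 1 -> x <= x' -> off t x y <= off t x' y.
Proof. by move=> t1 xx'; rewrite /off lerD2r ler_wpM2l ?subr_ge0 // ler_int. Qed.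

Lemma mindE P : th P < 1 -> mind R N P = scale (th P) * (mu P - (1 - th P)).
Proof.
move=> t1; rewrite /mind (HF_th (thP P)) lt_eqF //.
have [[k Hk] Hinf] := white_exact t1.
have fr_ge (n : nat) : (`|k| <= n)%N -> mu P - (1 - th P) <= off (th P) (fr P n) n.
  move=> kn; have [_ f1 fP] := frP n (thP P) t1; have [f0 nP] := fr_white f1 fP.
  by have := Hk _ _ f0 (le0z_nat n) (nat_ge kn) nP; rewrite off_succ; lra.
have sc0 := scale_gt0 (th_ge0 P).
apply: set_min_eq.
  apply/infinite_natP => m; have [x [y [x0 y0 my nP oE]]] := Hinf (`|k| + m)%N%:Z.
  rewrite -(gez0_abs y0) lez_nat in my; exists `|y|%N.
    by apply: leq_trans my; apply: leq_addl.
  rewrite /mkset dist_belt //; congr (_ * _); apply/le_anti.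
  rewrite fr_ge ?(leq_trans (leq_addr _ _) my) //=.
  have [_ f1 fP] := frP `|y|%N (thP P) t1.
  have fx : fr P `|y| < x.
    by rewrite ltNge; apply/negP => /(fP _ x0); rewrite gez0_abs.
  rewrite -(gez0_abs y0) in oE.
  by rewrite lerBrDr -off_succ -oE off_homo_x ?lezD1.
move=> r /infinite_natP/(_ `|k|%N)[n kn ->].
by rewrite dist_belt // ler_pM2l //; apply: fr_ge.
Qed.

Lemma maxdE P : 0 < th P < 1 -> maxd R N P = scale (th P) * nu P.
Proof.
move=> t01; have /andP[t0 t1] := t01; rewrite /maxd (HF_th (thP P)) lt_eqF //.
have [[k Hk] Hinf] := black_exact t01.
have sc0 := scale_gt0 (th_ge0 P).
have [m Hm] := fr_unbounded thP `|k|%N t01.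
have fr_le (n : nat) : (m <= n)%N -> off (th P) (fr P n) n <= nu P.
  move=> mn; have [_ f1 fP] := frP n (thP P) t1.
  have kf : k <= fr P n by apply: le_trans (Hm n mn); apply: lez_abs.
  by apply: Hk => //; apply/fP => //; apply: le_trans (Hm n mn).
apply: set_max_eq.
  apply/infinite_natP => i; have [_ _ _ whP] := thP P.
  have t1' : 0 < 1 - th P by rewrite subr_gt0.
  have [j Hj] := archi_lt (c P + th P * (m + i)%N%:R) t1'.
  have [x [y [jx bP oE]]] := Hinf j%:Z; have [x0 y0 _] := bP.
  have my : (m + i <= `|y|)%N.
    have := bk_off_le whP bP; rewrite -(ler_nat R) [`|y|%:R]pmulrn gez0_abs //.
    rewrite -(ler_pM2l t0) /off => le; have : (1 - th P) * j%:R <= (1 - th P) * x%:~R.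
      by rewrite ler_pM2l // pmulrn ler_int.
    by lra.
  exists `|y|%N; first by apply: leq_trans my; apply: leq_addl.
  rewrite /mkset dist_belt //; congr (_ * _); apply/le_anti.
  rewrite fr_le ?(leq_trans (leq_addr _ _) my) // andbT.
  have [_ f1 fP] := frP `|y|%N (thP P) t1.
  rewrite -(gez0_abs y0) in oE bP.
  by rewrite -oE off_homo_x //; apply/fP.
move=> r /infinite_natP/(_ m)[n kn ->].
by rewrite dist_belt // ler_pM2l //; apply: fr_le.
Qed.

Lemma maxd_HF P : th P = 1 -> maxd R N P = nu P.
Proof.
move=> e; rewrite /maxd (HF_th (thP P)) e eqxx.
have : P \in HF N by rewrite (HF_th (thP P)) e eqxx.
rewrite inE => /asboolP inf.
have ex : exists n, `[< frontier N P n = +oo%E >].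
  by have [n fn] := inf; exists n; apply/asboolP.
case: (ex_minnP ex) => h /asboolP fh minh.
have -> : HF_height N P = h.
  apply: set_min_eq => // n fn; rewrite leEnat; apply: minh; exact/asboolP.
have /(frontier_infty N P h) rowh := fh.
have [|upper lower] := nuP (P := P); first by rewrite e.
rewrite e in lower upper.
have offE x y : off 1 x y = - y%:~R :> R by rewrite /off subrr mul0r mul1r sub0r.
have [m Hm] : exists m : nat, forall i : 'I_h, ~ bk P m%:Z (i : nat)%:Z.
  apply: uniform_nat => [i n n' nn' nb bP|i].
    by apply: nb; apply: (bk_mono bP).
  apply: contrapT => /forallNP all; suff /asboolP/minh : frontier N P i = +oo%E.
    by rewrite leqNgt ltn_ord.
  apply/(frontier_infty N P i) => x x0.
  by apply: contrapT => nb; apply: (all `|x|%N); rewrite gez0_abs.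
apply/le_anti/andP; split.
- apply/ler_addgt0Pr => eta eta0; have [k Hk] := upper eta eta0.
  have x0 : 0 <= Num.max k 0 by rewrite le_max lexx orbT.
  have := Hk (Num.max k 0) h%:Z _ (rowh _ x0).
  by rewrite offE -pmulrn le_max lexx; apply.
- apply/ler_addgt0Pr => eta eta0; have [x [y [mx bP]]] := lower eta m%:Z eta0.
  rewrite offE => le; have [_ y0 _] := bP.
  have hy : h%:Z <= y.
    rewrite leNgt -(gez0_abs y0) ltz_nat; apply/negP => yh.
    apply: (Hm (Ordinal yh)) => /=; rewrite gez0_abs //.
    exact: (bk_mono bP).
  rewrite -(ler_int R) -pmulrn in hy; move: le hy.
  by move: (y%:~R) (h%:R) => *; lra.
Qed.

Lemma leLE P P' : th P < 1 -> th P' < 1 ->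
  leL R N P P' = (th P < th P') || (th P == th P') && (mu P <= mu P').
Proof.
move=> t1 t1'; rewrite /leL slope_lt slope_eq; congr (_ || _).
case: eqVneq => //= e; rewrite !mindE // -e ler_pM2l ?scale_gt0 //.
by rewrite lerD2r.
Qed.

Lemma leRE P P' : 0 < th P -> 0 < th P' ->
  leR R N P P' = (th P' < th P) || (th P == th P') && (nu P' <= nu P).
Proof.
move=> t0 t0'; rewrite /leR slope_lt slope_eq; congr (_ || _).
case: eqVneq => //= e.
have [e1|n1] := eqVneq (th P) 1; first by rewrite !maxd_HF // -e.
have t1 : th P < 1 by rewrite lt_neqAle n1 th_le1.
by rewrite !maxdE -?e ?t0 // ler_pM2l // scale_gt0.
Qed.

Lemma planes_msE P : 0 < th P < 1 ->
  planes_ms R N (slope P) = max_span th mu nu (th P).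
Proof.
move=> t01; have /andP[t0 t1] := t01.
have spandE P' : th P' = th P ->
    spand R N P' = scale (th P) * (nu P' - mu P' + (1 - th P)).
  by move=> e; rewrite /spand maxdE ?e // mindE e //; ring.
have same P' : (P' \in planes_of_slope R N (slope P)) = (th P' == th P).
  by rewrite inE slope_eq.
apply/setP => P'; rewrite !inE slope_eq; case: eqVneq => //= e.
apply: eq_forallb => P''; rewrite same; case: eqVneq => //= e'.
by rewrite !spandE // ler_pM2l ?scale_gt0 // lerD2r.
Qed.

Lemma rnb_off P (k m n : nat) : th P < 1 -> rnb k (belt_line R N P) (m, n) ->
  k%:R - 1 < off (th P) m%:Z n%:Z.
Proof.
move=> t1; rewrite /belt_line /rnb /off /= -!pmulrn.
have [[e _]|[e ->]|[/andP[t0 _] [a -> ae]]] := slope_cases P.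
- by rewrite e ltxx in t1.
- by rewrite /= e => /andP[+ _]; rewrite add0r mulr1 subr0 mul1r mul0r subr0.
rewrite /= ae subr0 /Defs.step => /andP[+ _].
have tn0 : th P != 0 by rewrite gt_eqF.
have un0 : 1 - th P != 0 by rewrite gt_eqF // subr_gt0.
rewrite -(ltr_pM2l (_ : 0 < 1 - th P)) ?subr_gt0 //.
have -> : (1 - th P) * (n%:R / ((1 - th P) / th P) +
   (k%:R - 1) * (1 + ((1 - th P) / th P)^-1)) = th P * n%:R + (k%:R - 1).
  by field; rewrite tn0 un0.
by lra.
Qed.

Lemma lnb_off P (k m n : nat) : 0 < th P -> lnb k (belt_line R N P) (m, n) ->
  off (th P) m%:Z n%:Z < - (k%:R - 1).
Proof.
move=> t0; rewrite /belt_line /lnb /off /= -!pmulrn.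
have [[e ->]|[e _]|[/andP[_ t1] [a -> ae]]] := slope_cases P.
- rewrite /= rmorph0 eqxx /= e => /andP[+ _].
  by rewrite mul0r !add0r subrr mul0r mul1r sub0r ltrN2.
- by rewrite e ltxx in t0.
rewrite /= ae; have tn0 : th P != 0 by rewrite gt_eqF.
have un0 : 1 - th P != 0 by rewrite gt_eqF // subr_gt0.
rewrite mulf_eq0 invr_eq0 (negPf tn0) (negPf un0) /= subr0 /Defs.step => /andP[_].
rewrite -(ltr_pM2l (_ : 0 < 1 - th P)) ?subr_gt0 //.
have -> : (1 - th P) * (n%:R / ((1 - th P) / th P) -
   (k%:R - 1) * (1 + ((1 - th P) / th P)^-1)) = th P * n%:R - (k%:R - 1).
  by field; rewrite tn0 un0.
by lra.
Qed.

End Orders.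

(** * Classes of planes *)

Section Classes.

Variables (Q : finType) (le : rel (plane Q)).
Hypotheses (le_rfl : reflexive le) (le_tr : transitive le).

Let e : rel (plane Q) := fun P P' => le P P' && le P' P.

Lemma card_classes (D : {set plane Q}) :
  #|equivalence_partition e D| = #|[set [set y | e x y] | x in D]|.
Proof.
have -> : equivalence_partition e D =
    [set D :&: C | C : {set plane Q} in [set [set y | e x y] | x in D]].
  rewrite -imset_comp; apply: eq_imset => x /=.
  by apply/setP => y; rewrite !inE.
apply: card_in_imset => _ _ /imsetP[x xD ->] /imsetP[x' x'D ->] /setP eqC.
have : e x' x by have := eqC x; rewrite !inE xD /= {1}/e le_rfl.
move=> /andP[x'x xx']; apply/setP => y; rewrite !inE /e.
by apply/andP/andP => -[u v]; split; eauto using le_tr.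
Qed.

Lemma num_classes_lt (A B : {set plane Q}) y : A \subset B -> y \in B ->
  (forall x, x \in A -> ~~ e x y) ->
  (#|equivalence_partition e A| < #|equivalence_partition e B|)%N.
Proof.
move=> AB yB Ay; rewrite !card_classes; apply: proper_card.
apply/properP; split; first exact: imsetS.
exists [set z | e y z]; first exact: imset_f.
apply/imsetP => -[x xA /setP/(_ y)]; rewrite !inE {1}/e le_rfl /=.
by rewrite (negPf (Ay x xA)).
Qed.

Lemma num_classes_gt0 (s : seq (plane Q)) P : P \in s -> (0 < num_classes e s)%N.
Proof.
move=> Ps; apply: (leq_ltn_trans (leq0n _) (num_classes_lt (A := finset.set0) (y := P) _ _ _)).
- exact: finset.sub0set.
- by rewrite inE.
- by move=> x; rewrite inE.
Qed.

Lemma sorted_classes (P0 : plane Q) (s : seq (plane Q)) (i j : nat) :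
    sorted le s -> (i < size s)%N -> (j < size s)%N ->
    ~~ le (nth P0 s i) (nth P0 s j) ->
  (j < i)%N /\ (num_classes e (take j.+1 s) < num_classes e (take i.+1 s))%N.
Proof.
move=> srt si sj nle.
have homo k l : (k < size s)%N -> (l < size s)%N -> (k <= l)%N ->
    le (nth P0 s k) (nth P0 s l).
  by move=> sk sl; apply: (sorted_leq_nth le_tr le_rfl).
have ji : (j < i)%N by rewrite ltnNge; apply: contra nle => /homo->.
split=> //; apply: (num_classes_lt (y := nth P0 s i)).
- apply/fintype.subsetP => P; rewrite !inE => /(nthP P0)[k].
  rewrite size_take_min leq_min => /andP[kj ks]; rewrite nth_take // => <-.
  apply/(nthP P0); exists k; last by rewrite nth_take // (leq_trans kj) // ltnW.
  by rewrite size_take_min leq_min ks (leq_trans kj) // ltnW.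
- rewrite inE; apply/(nthP P0); exists i; last by rewrite nth_take.
  by rewrite size_take_min leq_min ltnSn.
move=> P; rewrite inE => /(nthP P0)[k].
rewrite size_take_min leq_min => /andP[kj ks]; rewrite nth_take // => <-.
apply: contra nle => /andP[_ ik]; apply: le_tr ik _; exact: homo.
Qed.

End Classes.

Section Preorders.

Variables (R : realType) (Q Act : finType) (N : ocn Q Act).

Lemma leL_refl : reflexive (leL R N).
Proof. by move=> P; rewrite /leL eqxx lexx orbT. Qed.

Lemma leR_refl : reflexive (leR R N).
Proof. by move=> P; rewrite /leR eqxx lexx orbT. Qed.

Lemma leL_trans : transitive (leL R N).
Proof.
move=> y x z; rewrite /leL => /orP[xy|/andP[/eqP-> xy]] /orP[yz|/andP[/eqP e yz]].
- by rewrite (lt_trans yz xy).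
- by rewrite -e xy.
- by rewrite yz.
- by rewrite e eqxx (le_trans xy yz) orbT.
Qed.

Lemma leR_trans : transitive (leR R N).
Proof.
move=> y x z; rewrite /leR => /orP[xy|/andP[/eqP-> xy]] /orP[yz|/andP[/eqP e yz]].
- by rewrite (lt_trans xy yz).
- by rewrite -e xy.
- by rewrite yz.
- by rewrite e eqxx (le_trans yz xy) orbT.
Qed.

End Preorders.

Section Main.

Variables (R : realType) (Q Act : finType) (N : ocn Q Act).

Implicit Types (P : plane Q) (x y : int).

Local Notation bk := (bk N).

Variables (th c mu nu : plane Q -> R).
Hypothesis thP : forall P, belted N (th P) (c P) P.
Hypothesis muP : forall P, th P < 1 -> white_liminf N (th P) P (mu P).
Hypothesis nuP : forall P, 0 < th P -> black_limsup N (th P) P (nu P).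

Lemma rnb_white (z : nat) (Ps : z.-tuple (plane Q)) :
    [set P in Ps] = VF N :|: SF N -> sorted (leL R N) Ps ->
  forall (i : 'I_z) (m n : nat),
    rnb (sigmaL R N Ps i) (belt_line R N (tnth Ps i)) (m, n) ->
    white N (tnth Ps i) m n.
Proof.
move=> PsE srt.
have inPs P : (P \in Ps) = (th P < 1).
  move/setP/(_ P): PsE; rewrite inE => ->.
  rewrite finset.in_setU (VF_th (thP P)) (SF_th (thP P)).
  have [/andP[t0 _] _ _ _] := thP P.
  by case: eqVneq => [->|n0]; rewrite ?ltr01 // lt_neqAle eq_sym n0 t0.
pose P0 i := tnth Ps i.
have main k (i : 'I_z) : (i < k)%N -> forall x y, 0 <= x -> 0 <= y ->
    (sigmaL R N Ps i)%:R - 1 < off (th (P0 i)) x y -> ~ bk (P0 i) x y.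
  elim: k i => // k IH i ik.
  have ti : th (P0 i) < 1 by rewrite -inPs mem_tnth.
  apply: (white_right thP muP ti).
    apply: (num_classes_gt0 (@leL_refl R Q Act N) (@leL_trans R Q Act N) (P := P0 i)).
    apply/(nthP (P0 i)); exists i; last by rewrite nth_take // -tnth_nth.
    by rewrite size_take_min leq_min size_tuple ltn_ord ltnSn.
  move=> P lt; have tP : th P < 1.
    by case: lt => [/lt_trans->//|[->]].
  have [j Pj] : exists j, P = P0 j by apply/tnthP; rewrite inPs.
  have nle : ~~ leL R N (P0 i) P.
    rewrite (leLE thP muP nuP) // negb_or -leNgt; case: lt => [lt|[-> lt]].
      by rewrite (ltW lt) gt_eqF.
    by rewrite lexx eqxx -ltNge.
  rewrite Pj /P0 !(tnth_nth (P0 i)) in nle.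
  have [||ji sji] := sorted_classes (@leL_refl R Q Act N) (@leL_trans R Q Act N) srt _ _ nle.
  - by rewrite size_tuple.
  - by rewrite size_tuple.
  exists (sigmaL R N Ps j) => //; rewrite Pj; apply: IH.
  exact: leq_trans ji _.
move=> i m n /(rnb_off thP muP nuP) Hoff /bk_nat.
by apply: (main z i) => //; apply: Hoff; rewrite -inPs mem_tnth.
Qed.

Lemma lnb_black (z : nat) (Ps : z.-tuple (plane Q)) :
    [set P in Ps] = HF N :|: SF N -> sorted (leR R N) Ps ->
  forall (i : 'I_z) (m n : nat),
    lnb (sigmaR R N Ps i) (belt_line R N (tnth Ps i)) (m, n) ->
    black N (tnth Ps i) m n.
Proof.
move=> PsE srt.
have inPs P : (P \in Ps) = (0 < th P).
  move/setP/(_ P): PsE; rewrite inE => ->.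
  rewrite finset.in_setU (HF_th (thP P)) (SF_th (thP P)).
  have [/andP[_ t1] _ _ _] := thP P.
  by case: eqVneq => [->|n0]; rewrite ?ltr01 // [_ < 1]lt_neqAle n0 t1 !andbT.
pose P0 i := tnth Ps i.
have main k (i : 'I_z) : (i < k)%N -> forall x y, 0 <= x -> 0 <= y ->
    off (th (P0 i)) x y < - ((sigmaR R N Ps i)%:R - 1) -> bk (P0 i) x y.
  elim: k i => // k IH i ik.
  have ti : 0 < th (P0 i) by rewrite -inPs mem_tnth.
  apply: (black_left thP nuP ti).
    apply: (num_classes_gt0 (@leR_refl R Q Act N) (@leR_trans R Q Act N) (P := P0 i)).
    apply/(nthP (P0 i)); exists i; last by rewrite nth_take // -tnth_nth.
    by rewrite size_take_min leq_min size_tuple ltn_ord ltnSn.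
  move=> P lt; have tP : 0 < th P.
    by case: lt => [/(lt_trans ti)|[->]].
  have [j Pj] : exists j, P = P0 j by apply/tnthP; rewrite inPs.
  have nle : ~~ leR R N (P0 i) P.
    rewrite (leRE thP muP nuP) // negb_or -leNgt; case: lt => [lt|[-> lt]].
      by rewrite (ltW lt) lt_eqF.
    by rewrite lexx eqxx -ltNge.
  rewrite Pj /P0 !(tnth_nth (P0 i)) in nle.
  have [||ji sji] := sorted_classes (@leR_refl R Q Act N) (@leR_trans R Q Act N) srt _ _ nle.
  - by rewrite size_tuple.
  - by rewrite size_tuple.
  exists (sigmaR R N Ps j) => //; rewrite Pj; apply: IH.
  exact: leq_trans ji _.
move=> i m n /(lnb_off thP muP nuP) Hoff; apply/bk_nat.
by apply: (main z i) => //; apply: Hoff; rewrite -inPs mem_tnth.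
Qed.

End Main.

(** * Polynomial bounds *)

Lemma hole (T : finType) (C : int -> T -> Prop) (a : nat) :
    (forall t v v', C v t -> C v' t -> v = v') ->
  exists2 v : nat, (a <= v <= a + #|T|)%N & forall t, ~ C v%:Z t.
Proof.
move=> uniqC; apply: contrapT => nohole.
have /choice[f fP] (i : 'I_#|T|.+1) : exists t, C (a + i)%N%:Z t.
  apply: contrapT => noC; apply: nohole; exists (a + i)%N.
    by rewrite leq_addr leq_add2l -ltnS ltn_ord.
  by move=> t Ct; apply: noC; exists t.
suff /leq_card : injective f by rewrite card_ord ltnn.
move=> i j ij; apply/val_inj/(@addnI a).
by have := fP j; rewrite -ij => /(uniqC _ _ _ (fP i)) [].
Qed.

Lemma ord_of_int (m : nat) (y : int) : 0 <= y <= m%:Z ->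
  exists i : 'I_m.+1, y = (i : nat)%:Z.
Proof.
move=> y0m; have lt : (`|y| < m.+1)%N by lia.
by exists (Ordinal lt) => /=; lia.
Qed.

Section Corners.

Variables (Q Act : finType) (N : ocn Q Act).

Implicit Types (P : plane Q) (x y d e : int).

Local Notation bk := (bk N).

(* A column [v] without corners separates the corners to its right from the
   rest: shifting them by one would give a larger simulation. *)
Lemma horizontal_corner (H : {set plane Q}) (m k : nat) :
    (forall P x y, P \in H -> 0 <= x -> m%:Z < y -> bk P x y) ->
    (forall P x y, P \notin H -> bk P x y -> y <= m%:Z + 1 -> x <= k%:Z) ->
  forall P x y, P \in H -> bk P x y -> ~ bk P (x + 1) y ->
    x <= (k.+1 + #|{: plane Q * 'I_m.+1}|)%N%:Z.
Proof.
move=> blackH farH P0 x0 y0 P0H bP0 nP0; have [x00 y00 _] := bP0.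
have rowH P x y : P \in H -> bk P x y -> ~ bk P (x + 1) y -> 0 <= y <= m%:Z.
  move=> PH bP nP; have [x1 -> _] := bP; rewrite leNgt /=; apply/negP => my.
  by apply: nP; apply: blackH => //; rewrite addr_ge0.
pose C (v : int) (t : plane Q * 'I_m.+1) :=
  [/\ t.1 \in H, bk t.1 v (t.2 : nat)%:Z & ~ bk t.1 (v + 1) (t.2 : nat)%:Z].
have [t v v' [_ bv nv] [_ bv' nv']|v /andP[kv vK] noC] := @hole _ C k.+1.
  have [v0 _ _] := bv; have [v'0 _ _] := bv'.
  have [lt|lt|//] := ltgtP v v'.
    by case: nv; apply: (bk_mono bv') => //; [rewrite addr_ge0|rewrite lezD1].
  by case: nv'; apply: (bk_mono bv) => //; [rewrite addr_ge0|rewrite lezD1].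
have nocorner P y : P \in H -> bk P v%:Z y -> ~ bk P (v%:Z + 1) y -> False.
  move=> PH bP nP; have [i ei] := ord_of_int (rowH _ _ _ PH bP nP).
  by apply: (noC (P, i)); split=> //=; rewrite -ei.
rewrite leNgt; apply/negP => ltx0.
have vx0 : v%:Z < x0 by apply: le_lt_trans ltx0; rewrite lez_nat.
pose S P x y := bk P x y \/
  [/\ P \in H, bk P (x - 1) y, ~ bk P x y & v%:Z < x - 1].
suff : bk P0 (x0 + 1) y0 by [].
apply: (@bk_coind _ _ N S); last first.
  by right; rewrite addrK; split.
move=> P x y [bP|[PH bP nP vx]].
  have [x1 y1 _] := bP; split=> // a d p Pd xd.
  by have [e [q [Pe bQ]]] := bk_step bP Pd xd; exists e, q; split=> //; left.
have [x1 y1 _] := bP; split=> [|//|a d p Pd xd]; first by rewrite (le_trans x1) // gerBl.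
have xgt : 0 < x - 1 by apply: le_lt_trans vx.
have [e [q [Pe bQ]]] := bk_step bP Pd (step_ge0 xgt (rule_le1 Pd)).
exists e, q; split=> //.
have [bQ'|nQ] := EM (bk (p, q) (x + d) (y + e)); [by left|right].
rewrite addrAC in bQ.
have vx' : v%:Z <= x + d - 1.
  have /andP[d1 _] := rule_le1 Pd.
  by move: vx d1; lia.
have [QH|QH] := boolP ((p, q) \in H).
  split=> //; rewrite lt_neqAle vx' andbT; apply/eqP => ev.
  by apply: (nocorner (p, q) (y + e)); rewrite ?ev ?subrK.
have nP' : ~ bk P (x - 1 + 1) y by rewrite subrK.
have /andP[_ ym] := rowH _ _ _ PH bP nP'.
have /andP[_ e1] := rule_le1 Pe.
have := le_trans vx' (farH _ _ _ QH bQ (lerD ym e1)).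
by rewrite lez_nat leqNgt kv.
Qed.

Lemma vertical_corner (V : {set plane Q}) (m k : nat) :
    (forall P x y, P \in V -> bk P x y -> x <= m%:Z) ->
    (forall P x y, P \notin V -> 0 <= x -> x <= m%:Z + 1 -> k%:Z < y -> bk P x y) ->
  forall P x y, P \in V -> 0 <= y -> bk P x (y + 1) -> ~ bk P x y ->
    y <= (k.+1 + #|{: plane Q * 'I_m.+1}|)%N%:Z.
Proof.
move=> boundV farV P0 x0 y0 P0V y00 bP0 nP0.
have colV P x y : P \in V -> bk P x y -> 0 <= x <= m%:Z.
  by move=> PV bP; have [-> _ _] := bP; apply: boundV bP.
pose C (v : int) (t : plane Q * 'I_m.+1) :=
  [/\ t.1 \in V, 0 <= v, bk t.1 (t.2 : nat)%:Z (v + 1) & ~ bk t.1 (t.2 : nat)%:Z v].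
have [t v v' [_ v0 bv nv] [_ v'0 bv' nv']|v /andP[kv vK] noC] := @hole _ C k.+1.
  have [lt|lt|//] := ltgtP v v'.
    by case: nv'; apply: (bk_mono bv) => //; rewrite lezD1.
  by case: nv; apply: (bk_mono bv') => //; rewrite lezD1.
have nocorner P x : P \in V -> bk P x (v%:Z + 1) -> ~ bk P x v%:Z -> False.
  move=> PV bP nP; have [i ei] := ord_of_int (colV _ _ _ PV bP).
  by apply: (noC (P, i)); split=> //=; rewrite -ei.
rewrite leNgt; apply/negP => lty0.
have vy0 : v%:Z < y0 by apply: le_lt_trans lty0; rewrite lez_nat.
pose S P x y := bk P x y \/
  [/\ P \in V, bk P x (y + 1), ~ bk P x y & v%:Z < y].
suff : bk P0 x0 y0 by [].
apply: (@bk_coind _ _ N S); last by right.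
move=> P x y [bP|[PV bP nP vy]].
  have [x1 y1 _] := bP; split=> // a d p Pd xd.
  by have [e [q [Pe bQ]]] := bk_step bP Pd xd; exists e, q; split=> //; left.
have [x1 _ _] := bP; have ygt : 0 < y by apply: le_lt_trans vy.
split=> [//||a d p Pd xd]; first exact: ltW.
have [e [q [Pe bQ]]] := bk_step bP Pd xd.
exists e, q; split=> //.
have [bQ'|nQ] := EM (bk (p, q) (x + d) (y + e)); [by left|right].
rewrite addrAC in bQ.
have vy' : v%:Z <= y + e by have /andP[e1 _] := rule_le1 Pe; move: vy e1; lia.
have [QV|QV] := boolP ((p, q) \in V).
  split=> //; rewrite lt_neqAle vy' andbT; apply/eqP => ev.
  by apply: (nocorner (p, q) (x + d)); rewrite ?ev.
case: nQ; have /andP[_ xm] := colV _ _ _ PV bP.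
have /andP[_ d1] := rule_le1 Pd.
apply: farV => //; first exact: lerD.
by apply: lt_le_trans vy'; rewrite ltz_nat.
Qed.

End Corners.

Section Bounds.

Variables (R : realType) (Q Act : finType) (N : ocn Q Act).

Implicit Types (P : plane Q) (x y : int).

Local Notation bk := (bk N).
Local Notation fr := (fr N).

Lemma belt_data : exists th c mu nu : plane Q -> R,
  [/\ forall P, belted N (th P) (c P) P,
      forall P, th P < 1 -> white_liminf N (th P) P (mu P) &
      forall P, 0 < th P -> black_limsup N (th P) P (nu P)].
Proof.
have /choice[tc tcP] P : exists tc : R * R, belted N tc.1 tc.2 P.
  by have [th [c [? ? ? ?]]] := belt R N P; exists (th, c).
have /choice[mu muP] P : exists mu, (tc P).1 < 1 -> white_liminf N (tc P).1 P mu.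
  have [lt|] := ltP (tc P).1 1; last by exists 0.
  by have [mu muP] := white_liminf_exists (tcP P) lt; exists mu.
have /choice[nu nuP] P : exists nu, 0 < (tc P).1 -> black_limsup N (tc P).1 P nu.
  have [lt|] := ltP 0 (tc P).1; last by exists 0.
  by have [nu nuP] := black_limsup_exists (tcP P) lt; exists nu.
by exists (fun P => (tc P).1), (fun P => (tc P).2), mu, nu.
Qed.

Variables (th c mu nu : plane Q -> R).
Hypothesis thP : forall P, belted N (th P) (c P) P.
Hypothesis muP : forall P, th P < 1 -> white_liminf N (th P) P (mu P).
Hypothesis nuP : forall P, 0 < th P -> black_limsup N (th P) P (nu P).

Local Notation M := #|{: plane Q}|.

Let th_ge0 P : 0 <= th P. Proof. by have [/andP[]] := thP P. Qed.
Let th_le1 P : th P <= 1. Proof. by have [/andP[]] := thP P. Qed.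

Lemma white_uniform P : th P < 1 -> wh N M%:R (th P) P.
Proof.
pose low P := [set P' | (th P' < th P) || (th P' == th P) && (mu P' < mu P)].
have low_lt P1 P' : P' \in low P1 -> (#|low P'| < #|low P1|)%N.
  move=> lt; apply: proper_card; apply/properP; split; last first.
    by exists P' => //; rewrite inE !ltxx andbF.
  apply/fintype.subsetP => P''; move: lt; rewrite !inE.
  case/orP => [lt|/andP[/eqP-> lt]] /orP[lt'|/andP[/eqP e lt']].
  - by rewrite (lt_trans lt' lt).
  - by rewrite e lt.
  - by rewrite lt'.
  - by rewrite e eqxx (lt_trans lt' lt) orbT.
have main k P' : (#|low P'| < k)%N -> th P' < 1 -> forall x y, 0 <= x -> 0 <= y ->
    (#|low P'|.+1)%:R - 1 < off (th P') x y -> ~ bk P' x y.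
  elim: k P' => // k IH P' lek t1; apply: (white_right thP muP t1) => // P'' lt.
  have Pl : P'' \in low P'.
    by rewrite inE; case: lt => [->//|[-> ->]]; rewrite eqxx orbT.
  exists #|low P''|.+1; first by rewrite ltnS low_lt.
  apply: IH; first exact: leq_trans (low_lt _ _ Pl) _.
  by case: lt => [/lt_trans->//|[->]].
move=> t1 x y x0 y0 lt; apply: (main #|low P|.+1) => //.
by apply: le_lt_trans lt; rewrite -natr1 addrK ler_nat max_card.
Qed.

Lemma black_uniform P : 0 < th P -> bl N M%:R (th P) P.
Proof.
pose low P := [set P' | (th P < th P') || (th P' == th P) && (nu P < nu P')].
have low_lt P1 P' : P' \in low P1 -> (#|low P'| < #|low P1|)%N.
  move=> lt; apply: proper_card; apply/properP; split; last first.
    by exists P' => //; rewrite inE !ltxx andbF.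
  apply/fintype.subsetP => P''; move: lt; rewrite !inE.
  case/orP => [lt|/andP[/eqP-> lt]] /orP[lt'|/andP[/eqP e lt']].
  - by rewrite (lt_trans lt lt').
  - by rewrite e lt.
  - by rewrite lt'.
  - by rewrite e eqxx (lt_trans lt lt') orbT.
have main k P' : (#|low P'| < k)%N -> 0 < th P' -> forall x y, 0 <= x -> 0 <= y ->
    off (th P') x y < - ((#|low P'|.+1)%:R - 1) -> bk P' x y.
  elim: k P' => // k IH P' lek t0; apply: (black_left thP nuP t0) => // P'' lt.
  have Pl : P'' \in low P'.
    by rewrite inE; case: lt => [->//|[-> ->]]; rewrite eqxx orbT.
  exists #|low P''|.+1; first by rewrite ltnS low_lt.
  apply: IH; first exact: leq_trans (low_lt _ _ Pl) _.
  by case: lt => [/(lt_trans t0)|[->]].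
move=> t0 x y x0 y0 lt; apply: (main #|low P|.+1) => //.
by apply: (lt_le_trans lt); rewrite lerN2 -natr1 addrK ler_nat max_card.
Qed.

Lemma plane_card P : 1 <= M%:R :> R.
Proof. by rewrite ler1n; apply/card_gt0P; exists P. Qed.

Lemma slope_room P : (th P < 1 -> 1 <= 2 * M%:R * (1 - th P)) /\
  (0 < th P -> 1 <= 2 * M%:R * th P).
Proof.
have M1 := plane_card P.
have [t0|n0] := eqVneq (th P) 0.
  by rewrite t0 ltxx; split=> // _; lra.
have [t1|n1] := eqVneq (th P) 1.
  by rewrite t1 ltxx; split=> // _; lra.
have t01 : 0 < th P < 1 by rewrite !lt_neqAle eq_sym n0 n1 th_ge0 th_le1.
have [a [b [/andP[a1 aM] /andP[b1 bM] e _ _]]] := slope_ratio thP muP nuP t01.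
have {}a1 : 1 <= a%:R :> R by rewrite ler1n.
have {}b1 : 1 <= b%:R :> R by rewrite ler1n.
have {}aM : a%:R <= M%:R :> R by rewrite ler_nat (leq_trans aM) // max_card.
have {}bM : b%:R <= M%:R :> R by rewrite ler_nat (leq_trans bM) // max_card.
split=> _.
  have : (a%:R + b%:R) * (1 - th P) <= 2 * M%:R * (1 - th P).
    by apply: ler_wpM2r; [case/andP: t01; lra|lra].
  have -> : (a%:R + b%:R) * (1 - th P) = b%:R.
    by rewrite mulrDl [a%:R * _]mulrC e; ring.
  by lra.
have : (a%:R + b%:R) * th P <= 2 * M%:R * th P.
  by apply: ler_wpM2r; lra.
have -> : (a%:R + b%:R) * th P = a%:R.
  by rewrite mulrDl [b%:R * _]mulrC -e; ring.
by lra.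
Qed.

Let k := (2 * M * (2 * M + 1))%N.

Let kE : k%:R = 2 * M%:R * (2 * M%:R + 1) :> R.
Proof. by rewrite /k !natrM natrD !natrM. Qed.

Definition corner_bound : nat := (k.+1 + #|{: plane Q * 'I_M.+1}|)%N.

Lemma HF_bound P (n : nat) : P \in HF N -> (frontier N P n < +oo)%E ->
  (frontier N P n <= corner_bound%:Z%:E)%E.
Proof.
move=> PH; have [[-> _]|[f [-> f1 fP]] _] := frontierP N P n; first by rewrite ltxx.
rewrite lee_fin; have [f0|/ltW fneg] := leP 0 f; last exact: le_trans fneg _.
apply: (@horizontal_corner _ _ N (HF N) M k _ _ P f n%:Z) => //.
- move=> P' x y P'H x0 My; move: P'H; rewrite (HF_th (thP P')) => /eqP e.
  apply: black_uniform; rewrite ?e ?ltr01 //; first exact: le_trans (ltW My).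
  by rewrite /off subrr mul0r mul1r sub0r ltrN2 pmulrn ltr_int.
- move=> P' x y P'H bP yM; move: P'H; rewrite (HF_th (thP P')) => n1.
  have t1 : th P' < 1 by rewrite lt_neqAle n1 th_le1.
  have := bk_off_le (white_uniform t1) bP; have [_ y0 _] := bP.
  have [/(_ t1) room _] := slope_room P'; have M1 := plane_card P.
  rewrite -(ler_int R) rmorphD /= -pmulrn in yM.
  rewrite -(ler_int R) -pmulrn kE /off.
  have := th_ge0 P'; have y0' : 0 <= y%:~R :> R by rewrite ler0z.
  have [x0 _ _] := bP; have x0' : 0 <= x%:~R :> R by rewrite ler0z.
  move: x0' y0' yM room M1 t1; move: (x%:~R) (y%:~R) (M%:R) (th P') => X Y m t.
  move=> X0 Y0 Ym room m1 t1 t0 le.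
  have h1 : t * Y <= m + 1 by nra.
  have h2 : X <= (2 * m * (1 - t)) * X by nra.
  have h3 : (1 - t) * X <= 2 * m + 1 by lra.
  by nra.
- by apply/fP.
- have f10 : 0 <= f + 1 by rewrite addr_ge0.
  by move/(fP _ f10); rewrite gerDl.
Qed.

Lemma VF_bound P (n : nat) : P \in VF N ->
  (frontier N P n < set_max 0%:E (range (frontier N P)))%E -> n%:Z <= corner_bound%:Z.
Proof.
move=> PV; have := PV; rewrite (VF_th (thP P)) => /eqP e.
have t1 : th P < 1 by rewrite e ltr01.
have frE i : frontier N P i = (fr P i)%:E by have [] := frP i (thP P) t1.
have fr_iff i x : 0 <= x -> (bk P x i%:Z <-> x <= fr P i).
  by move=> x0; have [_ _ /(_ x x0)] := frP i (thP P) t1.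
have boundV P' x y : P' \in VF N -> bk P' x y -> x <= M%:Z.
  rewrite (VF_th (thP P')) => /eqP e' bP.
  have t1' : th P' < 1 by rewrite e' ltr01.
  have := bk_off_le (white_uniform t1') bP.
  by rewrite e' /off subr0 mul1r mul0r subr0 pmulrn ler_int.
have fr_ge i : -1 <= fr P i by have [] := frP i (thP P) t1.
have fr_le i : fr P i <= M%:Z.
  have [f0|/ltW fneg] := leP 0 (fr P i); last exact: le_trans fneg _.
  by apply: (boundV P _ i%:Z PV); apply/fr_iff.
have ex : exists v, `[< exists i, fr P i + 1 = v%:Z >].
  by exists `|(fr P 0 + 1)%R|%N; apply/asboolP; exists 0%N; have := fr_ge 0%N; lia.
have bounded v : `[< exists i, fr P i + 1 = v%:Z >] -> (v <= M.+1)%N.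
  by move=> /asboolP[i ei]; have := fr_le i; lia.
case: (ex_maxnP ex bounded) => v /asboolP[n1 en1] vmax.
have frmax i : fr P i <= fr P n1.
  have := fr_ge i; have := vmax `|(fr P i + 1)%R|%N.
  have : `[< exists j, fr P j + 1 = `|(fr P i + 1)%R|%N%:Z >].
    by apply/asboolP; exists i; have := fr_ge i; lia.
  by move=> h /(_ h); lia.
rewrite (@set_max_eq _ _ _ _ (frontier N P n1)); first last.
- by move=> _ [i _ <-]; rewrite !frE lee_fin.
- by exists n1.
rewrite !frE lte_fin => lt.
pose x := fr P n1; have x0 : 0 <= x by have := fr_ge n; rewrite /x; lia.
have nx : ~ bk P x n by move/(fr_iff _ _ x0); rewrite leNgt lt.
have ex1 : exists i, `[< bk P x (i : nat)%:Z >].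
  by exists n1; apply/asboolP/fr_iff.
case: (ex_minnP ex1) => l /asboolP bl minl.
have nl : (n < l)%N.
  by rewrite ltnNge; apply/negP => ln; apply: nx; apply: (bk_mono bl).
have l0 : (0 < l)%N by apply: leq_ltn_trans nl.
have le : (l.-1)%:Z <= corner_bound%:Z.
  apply: (@vertical_corner _ _ N (VF N) M k boundV _ P x l.-1%:Z) => //.
  - move=> P' x' y P'V x'0 x'M ky; move: P'V; rewrite (VF_th (thP P')) => n0.
    have t0 : 0 < th P' by rewrite lt_neqAle eq_sym n0 th_ge0.
    apply: (black_uniform t0) => //; first exact: le_trans (ltW ky).
    have [_ /(_ t0) room] := slope_room P'; have M1 := plane_card P.
    rewrite -(ler_int R) rmorphD /= -pmulrn in x'M.
    rewrite -(ltr_int R) -pmulrn kE in ky; rewrite /off.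
    have x'0' : 0 <= x'%:~R :> R by rewrite ler0z.
    have := th_le1 P'; move: x'0' x'M ky room M1 t0.
    move: (x'%:~R) (y%:~R) (M%:R) (th P') => X Y m t X0 Xm kY room m1 t0 t1'.
    have h1 : (1 - t) * X <= m + 1 by nra.
    have Y0 : 0 <= Y by nra.
    have h2 : Y <= (2 * m * t) * Y by nra.
    have h3 : 2 * m + 1 < t * Y.
      have : 2 * m * (2 * m + 1) < 2 * m * (t * Y) by lra.
      by rewrite ltr_pM2l //; lra.
    by lra.
  - have -> : l.-1%:Z + 1 = l%:Z by rewrite -{2}(prednK l0) -addn1 PoszD.
    exact: bl.
  - move=> bl1; have := minl l.-1; have -> : `[< bk P x l.-1%:Z >] by apply/asboolP.
    by move=> /(_ isT); rewrite -ltnS prednK // ltnn.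
apply: le_trans le; rewrite lez_nat.
by rewrite -ltnS prednK.
Qed.

End Bounds.

Definition bound_pol : {poly int} :=
  2%:P * 'X^2 * (2%:P * 'X^2 + 1) + 1 + 'X^2 * ('X^2 + 1).

Lemma bound_polE (Q : finType) : bound_pol.[#|Q|%:R] = (corner_bound Q)%:Z.
Proof.
rewrite /bound_pol !hornerE /= /corner_bound !card_prod card_ord !natz !expr2.
by move: #|Q| => q; lia.
Qed.

Theorem theorem5 :
  (forall (R : realType) (Q Act : finType) (N : ocn Q Act),
    [/\ (forall P : plane Q, P \in SF N ->
           exists dx dy : nat,
             [/\ (1 <= dx <= #|planes_ms R N (slope R N P)|)%N,
                 (1 <= dy <= #|planes_ms R N (slope R N P)|)%N
               & slope R N P = (dy%:R / dx%:R : rat)%:E]),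
        (forall (z : nat) (Ps : z.-tuple (plane Q)),
           [set P in Ps] = VF N :|: SF N ->
           sorted (leL R N) Ps ->
           forall (i : 'I_z) (m n : nat),
             rnb (sigmaL R N Ps i) (belt_line R N (tnth Ps i)) (m, n) ->
             white N (tnth Ps i) m n)
      & (forall (z : nat) (Ps : z.-tuple (plane Q)),
           [set P in Ps] = HF N :|: SF N ->
           sorted (leR R N) Ps ->
           forall (i : 'I_z) (m n : nat),
             lnb (sigmaR R N Ps i) (belt_line R N (tnth Ps i)) (m, n) ->
             black N (tnth Ps i) m n)])
  /\
  (exists pol : {poly int},
     forall (Q Act : finType) (N : ocn Q Act) (P : plane Q) (n : nat),
       (P \in HF N -> (frontier N P n < +oo)%E ->
          (frontier N P n <= (pol.[#|Q|%:R])%:E)%E)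
       /\
       (P \in VF N ->
          (frontier N P n < set_max 0%:E (range (frontier N P)))%E ->
          n%:Z <= pol.[#|Q|%:R])).
Proof.
split=> [R Q Act N|].
  have [th [c [mu [nu [thP muP nuP]]]]] := belt_data R N.
  split; [|exact: rnb_white thP muP nuP|exact: lnb_black thP muP nuP].
  move=> P; rewrite (SF_th (thP P)) => t01.
  rewrite (planes_msE thP muP nuP t01).
  have [x [y [xM yM _ _ ->]]] := slope_ratio thP muP nuP t01.
  by exists x, y.
exists bound_pol => Q Act N P n; rewrite bound_polE.
have [th [c [mu [nu [thP muP nuP]]]]] := belt_data Rdefinitions.R N.
split; [move=> PH fin|move=> PV lt].
  exact: (HF_bound thP muP nuP PH fin).
exact: (VF_bound thP muP nuP PV lt).
Qed.
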